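(* Suppose that the densities $g_S$ have finite second moments and satisfy, for a constant $c_1$ (not depending on $n$) and all $S'\subset S\subset\{1,\dots,n\}$, $$\log g_S(\theta)-\log g_S(\theta')\le c_1|S|+\tfrac1{64}\|\theta-\theta'\|^2\qquad\forall\,\theta,\theta'\in\mathbb{R}^S,$$ $$\bigl|\log g_S(\theta)-\log g_{S'}(\pi_{S'}\theta)\bigr|\le c_1|S|+\tfrac1{64}\|\pi_{S\setminus S'}\theta\|^2\qquad\forall\,\theta\in\mathbb{R}^S .$$ Suppose that for some $a\ge1$ and $b\ge e^{7+2c_1}$ and a constant $K$ not depending on $n$, $\pi_n(p)\le K e^{-ap\log(bn/p)}$ for every $p\in\{0,1,\dots,n\}$ (the exponent being $0$ for $p=0$). Then there is a constant $K'$, not depending on $n,p_n,s,r$, such that for any $1\le p_n\le n$, any $s\in(0,2)$, any $r\ge1$, and $r_n\ge0$ defined by $$r_n^2=\min_{1\le p\le n}\Bigl[\frac{s\,n^{2/s}}{2-s}\Bigl(\frac1p\Bigr)^{2/s-1}\Bigl(\frac{p_n}n\Bigr)^2\;\vee\;p\log\frac np\;\vee\;\log\frac1{\pi_n(p)}\Bigr]$$ (minimum over integers $p$), one has $$\sup_{\theta_0\in m_s[p_n]}P_{n,\theta_0}\,\Pi_n\bigl(\theta:\|\theta-\theta_0\|>80r_n+20r\mid X\bigr)\le K'e^{-r^2/10}.$$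
   Context: For $\theta\in\mathbb{R}^n$, $P_{n,\theta}$ denotes the $N_n(\theta,I)$ distribution of $X=(X_1,\dots,X_n)$, with Lebesgue density $p_{n,\theta}$, and $P_{n,\theta}T$ denotes the expectation of $T=T(X)$ under it. $\|\cdot\|$ is the Euclidean norm; $a\vee b=\max(a,b)$; $\pi_{S'}\theta=(\theta_i:i\in S')$ is coordinate projection. Weak $\ell_s$-ball: $m_s[p_n]=\{\theta\in\mathbb{R}^n:\frac1n\max_{1\le i\le n}i\,|\theta_{[i]}|^s\le(p_n/n)^s\}$, where $|\theta_{[1]}|\ge|\theta_{[2]}|\ge\cdots\ge|\theta_{[n]}|$ is the nonincreasing rearrangement of the absolute values of the coordinates of $\theta$. Prior $\Pi_n$ on $\mathbb{R}^n$: (P1) a dimension $p$ is drawn from a probability measure $\pi_n$ on $\{0,1,\dots,n\}$ with $\pi_n(p)>0$ for every $p$; (P2) given $p$, a subset $S\subset\{1,\dots,n\}$ with $|S|=p$ is drawn uniformly from the $\binom np$ subsets of size $p$; (P3) given $(p,S)$, the vector $\theta_S=(\theta_i:i\in S)$ is drawn from a probability density $g_S$ on $\mathbb{R}^S$ (if $p\ge1$), and the coordinates $\theta_i$, $i\notin S$, are set equal to $0$. The density $g_S$ depends on $S$ only through $|S|$ (identifying $\mathbb{R}^S$ with $\mathbb{R}^{|S|}$); by convention $g_\emptyset=1$. Posterior: $\Pi_n(B\mid X)=\int_B p_{n,\theta}(X)\,d\Pi_n(\theta)\big/\int p_{n,\theta}(X)\,d\Pi_n(\theta)$ for Borel $B\subset\mathbb{R}^n$.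 *)

(* Defs.v *)
From HB Require Import structures.
From mathcomp Require Import all_boot all_order all_algebra.
From mathcomp Require Import all_classical all_reals all_analysis.
From mathcomp Require Import measurable_realfun.

Set Implicit Arguments.
Unset Strict Implicit.
Unset Printing Implicit Defensive.

Import Order.TTheory GRing.Theory Num.Theory.
Import numFieldNormedType.Exports.

Local Open Scope classical_set_scope.
Local Open Scope ring_scope.

(* The library equips tuples with the sigma-algebra generated by the
   coordinates, i.e., here, with the Borel sets of R^n. *)
Notation vec R n := (n.-tuple (measurableTypeR R)).

Section lebesgue_vec.
Context (R : realType).
Local Open Scope ereal_scope.

Definition vcons n (z : measurableTypeR R * vec R n) : vec R n.+1 :=
  [tuple of z.1 :: z.2].

Lemma measurable_vcons n : measurable_fun setT (@vcons n).
Proof. by apply: measurable_cons. Qed.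

Section step.
Variables (n : nat) (m : {sigma_finite_measure set (vec R n) -> \bar R}).

Definition lebesgue_step : set (vec R n.+1) -> \bar R :=
  pushforward (@lebesgue_measure R \x m) (@vcons n).

Let step0 : lebesgue_step set0 = 0.
Proof. by rewrite /lebesgue_step /pushforward preimage_set0 measure0. Qed.

Let step_ge0 A : 0 <= lebesgue_step A.
Proof. by rewrite /lebesgue_step /pushforward measure_ge0. Qed.

Let step_sigma_additive : semi_sigma_additive lebesgue_step.
Proof.
move=> F mF tF mUF; rewrite /lebesgue_step /pushforward preimage_bigcup.
have mv B : measurable B -> measurable (@vcons n @^-1` B).
  by move=> mB; rewrite -[X in measurable X]setTI; exact: measurable_vcons.
apply: measure_semi_sigma_additive.
- by move=> k; exact: mv.
- apply/trivIsetP => /= i j _ _ ij; rewrite -preimage_setI.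
  by move/trivIsetP : tF => /(_ _ _ _ _ ij) ->//; rewrite preimage_set0.
- by rewrite -preimage_bigcup; exact: mv.
Qed.

HB.instance Definition _ := isMeasure.Build _ _ _ lebesgue_step
  step0 step_ge0 step_sigma_additive.

Let step_sigma_finite : sigma_finite setT lebesgue_step.
Proof.
have /sigma_finiteP[F [UF ndF Foo]] := sigma_finiteT (@lebesgue_measure R).
have /sigma_finiteP[G [UG ndG Goo]] := sigma_finiteT m.
pose h (t : vec R n.+1) : measurableTypeR R * vec R n :=
  (thead t, [tuple of behead t]).
have mh : measurable_fun setT h.
  apply/measurable_fun_pairP; split; first exact: measurable_tnth.
  exact: measurable_behead.
have hK : cancel (@vcons n) h.
  by move=> [x t]; congr pair; rewrite /vcons; apply: val_inj.
exists (fun k => h @^-1` (F k `*` G k)).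
  apply/esym/seteqP; split=> // t _.
  have [i _ Fi] : (\bigcup_i F i) (thead t) by rewrite -UF.
  have [j _ Gj] : (\bigcup_i G i) [tuple of behead t] by rewrite -UG.
  exists (maxn i j) => //; split => /=.
  - by move: Fi; exact/subsetPset/ndF/leq_maxl.
  - by move: Gj; exact/subsetPset/ndG/leq_maxr.
move=> k; have [mFk Fk] := Foo k; have [mGk Gk] := Goo k.
have mFG : measurable (F k `*` G k) by exact: measurableX.
split; first by rewrite -[X in measurable X]setTI; exact: mh.
rewrite /lebesgue_step /pushforward -comp_preimage.
rewrite (_ : h \o @vcons n = id); last by apply/funext => z; exact: hK.
rewrite preimage_id product_measure1E// lte_mul_pinfty//.
by rewrite ge0_fin_numE.
Qed.

HB.instance Definition _ := Measure_isSigmaFinite.Build _ _ _ lebesgue_step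
  step_sigma_finite.

End step.

(* Lebesgue measure on R^n (the unit mass at the empty tuple when n = 0) *)
Fixpoint lebesgue_vec n : {sigma_finite_measure set (vec R n) -> \bar R} :=
  match n with
  | 0 => \d_([tuple] : vec R 0)
  | n'.+1 => lebesgue_step (lebesgue_vec n')
  end.

End lebesgue_vec.

Section vectors.
Context (R : realType).
Implicit Types (n : nat).

Definition l2norm n (x : vec R n) : R := Num.sqrt (\sum_(i < n) tnth x i ^+ 2).

Definition l2dist n (x y : vec R n) : R :=
  l2norm ([tuple tnth x i - tnth y i | i < n] : vec R n).

(* R^S is identified with R^#|S| by listing S increasingly: coordinate i of
   R^S has rank index i (enum S).  An i outside S has index #|S|, so that
   nth returns its default 0. *)
Definition vproj n (S : {set 'I_n}) (x : vec R n) : vec R #|S| :=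
  [tuple tnth x (enum_val i) | i < #|S|].

Definition vembed n (S : {set 'I_n}) (x : vec R #|S|) : vec R n :=
  [tuple nth 0 x (index i (enum S)) | i < n].

Lemma vembedK n (S : {set 'I_n}) : cancel (@vembed n S) (@vproj n S).
Proof.
move=> x; apply: eq_from_tnth => i; rewrite !tnth_mktuple.
rewrite (enum_val_nth (enum_val i)) index_uniq ?enum_uniq -?cardE//.
by rewrite -tnth_nth.
Qed.

Lemma measurable_vembed n (S : {set 'I_n}) : measurable_fun setT (@vembed n S).
Proof.
apply/measurable_fun_tnthP => i.
have [iS|iS] := boolP (i \in S).
  have ltS : (index i (enum S) < #|S|)%N by rewrite cardE index_mem mem_enum.
  rewrite (_ : _ \o _ = fun x => tnth x (Ordinal ltS)).
    exact: measurable_tnth.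
  by apply/funext => x; rewrite /= tnth_mktuple (tnth_nth 0).
rewrite (_ : _ \o _ = cst 0) //.
apply/funext => x; rewrite /= tnth_mktuple nth_default// size_tuple.
by rewrite memNindex ?mem_enum// -cardE.
Qed.

(* |x_[i+1]|, the (i+1)-st largest absolute value of the coordinates of x *)
Definition rearr n (x : vec R n) (i : nat) : R :=
  nth 0 (sort (fun s t => t <= s) [seq `|t| | t <- x]) i.

Definition weak_ball n (s pn : R) : set (vec R n) :=
  [set x | n%:R^-1 * \big[Num.max/0]_(i < n) (i.+1%:R * rearr x i `^ s)
             <= (pn / n%:R) `^ s].

End vectors.

Section bayes.
Context (R : realType).

(* the Lebesgue density of N_n(theta, I) *)
Definition gauss_dens n (theta x : vec R n) : R :=
  \prod_(i < n) normal_pdf (tnth theta i) 1 (tnth x i).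

(* The expectation P_{n, theta} T of T(X) when X has density gauss_dens theta *)
Definition gauss_expect n (theta : vec R n) (T : vec R n -> \bar R) : \bar R :=
  \int[lebesgue_vec R n]_x (T x * (gauss_dens theta x)%:E)%E.

Record density (p : nat) := Density {
  dens :> vec R p -> R;
  dens_ge0 : forall x, 0 <= dens x;
  measurable_dens : measurable_fun setT dens;
  integral_dens : (\int[lebesgue_vec R p]_x (dens x)%:E = 1)%E }.

(* A probability on {0, ..., n}; values at arguments > n are irrelevant. *)
Record dim_prior (n : nat) := DimPrior {
  dimp :> nat -> R;
  dimp_gt0 : forall p, (p <= n)%N -> 0 < dimp p;
  dimp_sum1 : \sum_(p < n.+1) dimp p = 1 }.

Section prior.
Variables (n : nat) (pin : dim_prior n) (g : forall p, density p).
Local Open Scope ereal_scope.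

(* The subset S has probability pin(#|S|) / C(n, #|S|); given S, the vector is
   vembed S x with x of density g #|S|, which plays the role of g_S: the family
   g is indexed by the dimension because g_S depends on #|S| only.  For S = set0 the density is
   necessarily 1, since lebesgue_vec 0 is a unit mass. *)
Definition prior (B : set (vec R n)) : \bar R :=
  \sum_(S : {set 'I_n}) (pin #|S| / 'C(n, #|S|)%:R)%:E *
    \int[lebesgue_vec R #|S|]_(x in @vembed R n S @^-1` B) (g #|S| x)%:E.

Let weight_ge0 (S : {set 'I_n}) : (0 <= pin #|S| / 'C(n, #|S|)%:R)%R.
Proof.
apply: divr_ge0 => //; apply/ltW/dimp_gt0.
by rewrite -[X in (_ <= X)%N]card_ord max_card.
Qed.

Let int_ge0 p (D : set (vec R p)) :
  0 <= \int[lebesgue_vec R p]_(x in D) (g p x)%:E.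
Proof. by apply: integral_ge0 => x _; rewrite lee_fin dens_ge0. Qed.

Let prior0 : prior set0 = 0.
Proof.
by rewrite /prior big1// => S _; rewrite preimage_set0 integral_set0 mule0.
Qed.

Let prior_ge0 B : 0 <= prior B.
Proof. by apply: sume_ge0 => S _; rewrite mule_ge0// lee_fin. Qed.

Let prior_sigma_additive : semi_sigma_additive prior.
Proof.
move=> F mF tF mUF.
rewrite [X in X @ \oo --> _](_ : _ = fun k => \sum_(S : {set 'I_n})
    (pin #|S| / 'C(n, #|S|)%:R)%:E * \sum_(0 <= i < k)
      \int[lebesgue_vec R #|S|]_(x in @vembed R n S @^-1` F i) (g #|S| x)%:E).
  apply: cvg_nnesum => S _.
    by apply: nearW => k; rewrite mule_ge0 ?lee_fin// sume_ge0.
  apply: cvgeZl => //.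
  have mE B : measurable B -> measurable (@vembed R n S @^-1` B).
    by move=> mB; rewrite -[X in measurable X]setTI; exact: measurable_vembed.
  rewrite preimage_bigcup ge0_integral_bigcup//.
  - by apply: is_cvg_ereal_nneg_natsum_cond => k _ _; exact: int_ge0.
  - by move=> k; exact: mE.
  - apply/measurable_EFinP; apply: measurable_funTS; exact: measurable_dens.
  - by move=> x _; rewrite lee_fin dens_ge0.
  - apply/trivIsetP => /= i j _ _ ij; rewrite -preimage_setI.
    by move/trivIsetP : tF => /(_ _ _ _ _ ij) ->//; rewrite preimage_set0.
apply/funext => k; rewrite exchange_big/=; apply: eq_bigr => S _.
by rewrite ge0_sume_distrr.
Qed.

HB.instance Definition _ := isMeasure.Build _ _ _ prior
  prior0 prior_ge0 prior_sigma_additive.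

Let prior_setT : prior setT = 1.
Proof.
rewrite /prior; under eq_bigr do rewrite preimage_setT integral_dens mule1.
rewrite sumEFin; congr EFin.
rewrite -[RHS](dimp_sum1 pin).
rewrite (partition_big (fun S : {set 'I_n} => inord #|S| : 'I_n.+1) xpredT)//=.
apply: eq_bigr => p _.
have cardS (S : {set 'I_n}) : (inord #|S| == p) = (#|S| == p :> nat).
  rewrite -(inj_eq val_inj)/= inordK// ltnS.
  by rewrite -[X in (_ <= X)%N]card_ord max_card.
rewrite (eq_bigr (fun=> pin p / 'C(n, p)%:R)%R); last first.
  by move=> S; rewrite cardS => /eqP ->.
rewrite (eq_bigl (fun S : {set 'I_n} => #|S| == p) _ cardS) sumr_const.
have -> : #|[pred S : {set 'I_n} | #|S| == p]| = 'C(n, p).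
  have := card_draws 'I_n p; rewrite card_ord => <-.
  by apply: eq_card => S; rewrite !inE.
rewrite -[LHS]mulr_natr mulfVK// pnatr_eq0 -lt0n bin_gt0.
by rewrite -ltnS.
Qed.

HB.instance Definition _ := Measure_isProbability.Build _ _ _ prior prior_setT.

Definition posterior (B : set (vec R n)) (x : vec R n) : \bar R :=
  (\int[prior]_(theta in B) (gauss_dens theta x)%:E) /
  (\int[prior]_theta (gauss_dens theta x)%:E).

End prior.

(* The quantity minimised in the definition of r_n^2. *)
Definition rate_term n (pin : nat -> R) (s pn : R) (p : nat) : R :=
  Num.max
    (Num.max
      (s * n%:R `^ (2 / s) / (2 - s) * p%:R^-1 `^ (2 / s - 1) *
       (pn / n%:R) ^+ 2)
      (p%:R * ln (n%:R / p%:R)))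
    (ln (pin p)^-1).

(* The base value of the iterated minimum is the term p = 1, which belongs to
   the range as soon as 1 <= n. *)
Definition rate_sq n (pin : nat -> R) (s pn : R) : R :=
  \big[Num.min/rate_term n pin s pn 1]_(1 <= p < n.+1) rate_term n pin s pn p.

End bayes.

(* Main.v *)
Require Import Defs.
From mathcomp Require Import all_boot all_order all_algebra.
From mathcomp Require Import all_classical all_reals all_analysis.
From mathcomp Require Import measurable_realfun.
From mathcomp Require Import ring lra.

Set Implicit Arguments.
Unset Strict Implicit.
Unset Printing Implicit Defensive.

Import Order.TTheory GRing.Theory Num.Theory.
Import numFieldNormedType.Exports.

Local Open Scope classical_set_scope.
Local Open Scope ring_scope.

(* Let N_S be the contribution of the subset S to the numerator of the posterior
   probability of {|theta - theta0| > M}, and D its denominator.  As N_S <= D,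
   the ratio N_S / D is at most its square root, so that no tests are needed:
   it suffices to bound the sum over S of the expectations of sqrt(N_S / D).
   Let S0 index the p largest |theta0_i| and let theta' be theta0 with the
   coordinates outside S0 set to 0.  The conditions on g give
     g_S(theta) <= g_S0(theta') exp(c1 (|S| + 2 p) + |theta - theta'|^2 / 64)
   and a converse for S = S0, hence g_S0(theta') cancels in N_S / D.
   Inserting exp(3/32 (|theta - theta0|^2 - M^2)), which is at least 1 where
   |theta - theta0| > M, leaves Gaussian integrals that factor over the
   coordinates: coordinate i contributes at most exp((theta0_i - theta'_i)^2),
   times 4 if i is in S.  The sum over S converges because
   C(n, k) pi_n(k) <= K exp(- (6 + 2 c1) k), and exp(- 3/64 M^2) absorbs the
   remaining factor exp(O(r_n^2)). *)

(** The integral of a nonnegative function is the supremum of the integrals of the simple functions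
    below it, and this supremum grows with the function. The posterior can thus be bounded under the
    integral without a study of its measurability in the observation. *)
Lemma ge0_le_integralT d (T : measurableType d) (R : realType)
    (mu : {measure set T -> \bar R}) (f h : T -> \bar R) :
  (forall x, 0 <= f x)%E -> (forall x, f x <= h x)%E ->
  (\int[mu]_x f x <= \int[mu]_x h x)%E.
Proof.
move=> f0 fh; have h0 x : (0 <= h x)%E by exact: le_trans (f0 x) (fh x).
rewrite !ge0_integralTE//; apply: le_ereal_sup => _ [u uf <-].
by exists u => // x; exact: le_trans (uf x) (fh x).
Qed.

(** * Integrals against the prior *)

Section integral_prior.
Context (R : realType) (n : nat) (pin : dim_prior R n)
  (g : forall p, density R p).
Import HBNNSimple.
Local Open Scope ereal_scope.

Lemma prior_weight_ge0 (S : {set 'I_n}) :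
  (0 <= pin #|S| / 'C(n, #|S|)%:R)%R.
Proof.
by apply: divr_ge0 => //; apply/ltW/dimp_gt0; rewrite -[leqRHS]card_ord max_card.
Qed.

Let measurable_preimage_vembed (S : {set 'I_n}) (A : set (vec R n)) :
  measurable A -> measurable (@vembed R n S @^-1` A).
Proof. by move=> mA; rewrite -[X in measurable X]setTI; exact: measurable_vembed. Qed.

Let integral_prior_nnsfun (h : {nnsfun vec R n >-> R}) :
  \int[prior pin g]_theta (h theta)%:E =
  \sum_(S : {set 'I_n}) (pin #|S| / 'C(n, #|S|)%:R)%:E *
    \int[lebesgue_vec R #|S|]_x ((h (vembed x))%:E * (g #|S| x)%:E).
Proof.
rewrite integralT_nnsfun sintegralE.
transitivity (\sum_(k \in range h) \sum_(S : {set 'I_n})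
   (pin #|S| / 'C(n, #|S|)%:R)%:E * (k%:E *
    \int[lebesgue_vec R #|S|]_(x in @vembed R n S @^-1` (h @^-1` [set k]))
      (g #|S| x)%:E)).
  apply: eq_fsbigr => k /[!inE] -[t _ <-].
  rewrite /= /prior ge0_sume_distrr; last first.
    move=> S _; rewrite mule_ge0// ?lee_fin ?prior_weight_ge0//.
    by apply: integral_ge0 => x _; rewrite lee_fin dens_ge0.
  by apply: eq_bigr => S _; rewrite muleCA.
rewrite fsbig_finite//= exchange_big/=; apply: eq_bigr => S _.
rewrite -fsbig_finite// -ge0_mule_fsumr; last first.
  (* Nonnegativity is required for every real k; a value that [h] does not take, possibly negative,
     has an empty level set. *)
  move=> k; have [[t _ <-]|hk] := pselect (range h k).
    rewrite mule_ge0// ?lee_fin//.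
    by apply: integral_ge0 => x _; rewrite lee_fin dens_ge0.
  rewrite (_ : _ @^-1` _ = set0) ?integral_set0 ?mule0//.
  by apply/seteqP; split=> // x /= hx; apply: hk; rewrite -hx; exists (vembed x).
congr *%E.
have mE k : measurable (@vembed R n S @^-1` (h @^-1` [set k])).
  exact: measurable_preimage_vembed.
transitivity (\sum_(k \in range h) \int[lebesgue_vec R #|S|]_x
   ((k * \1_(@vembed R n S @^-1` (h @^-1` [set k])) x)%:E * (g #|S| x)%:E)).
  apply: eq_fsbigr => k /[!inE] -[t _ <-].
  set D := _ @^-1` _; have mD : measurable D by exact: mE.
  have mgD : measurable_fun setT ((fun x => (g #|S| x)%:E) \_ D).
    apply: (measurable_restrictT _ mD).1; apply/measurable_EFinP.
    apply: measurable_funTS; exact: measurable_dens.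
  rewrite integral_mkcond -(ge0_integralZl _ measurableT mgD)//=; last first.
  - by rewrite lee_fin.
  - by move=> x _; rewrite patchE; case: ifP => // _; rewrite lee_fin dens_ge0.
  apply: eq_integral => x _; rewrite patchE indicE.
  by case: ifP; rewrite (mulr1, mulr0) ?mule0 ?mul0e.
rewrite -ge0_integral_fsum//.
- apply: eq_integral => x _; rewrite -ge0_mule_fsuml; last first.
    by move=> k; exact: (nnfun_muleindic_ge0 _ k (vembed x)).
  by rewrite fsumEFin// [in RHS]fimfunE.
- move=> k; apply/measurable_EFinP/measurable_funM; last exact: measurable_dens.
  by apply: measurable_funM => //; exact: measurable_indic.
- move=> k x _; rewrite mule_ge0 ?lee_fin ?dens_ge0//.
  by have := nnfun_muleindic_ge0 h k (vembed x); rewrite lee_fin.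
Qed.

(** [prior] is given by its values on sets, so the formula holds for simple functions; monotone
    convergence, on both sides, extends it to nonnegative measurable ones. *)
Lemma integral_prior (f : vec R n -> \bar R) :
  measurable_fun setT f -> (forall theta, 0 <= f theta) ->
  \int[prior pin g]_theta f theta =
  \sum_(S : {set 'I_n}) (pin #|S| / 'C(n, #|S|)%:R)%:E *
    \int[lebesgue_vec R #|S|]_x (f (vembed x) * (g #|S| x)%:E).
Proof.
move=> mf f0; pose f_ := nnsfun_approx measurableT mf.
have f_f t : (f_ k t)%:E @[k --> \oo] --> f t.
  by apply: cvg_nnsfun_approx.
have nd t : {homo (fun k => (f_ k t)%:E) : m m' / (m <= m')%N >-> m <= m'}.
  by move=> m m' mm'; rewrite lee_fin; exact/lefP/nd_nnsfun_approx.
have cvl : \int[prior pin g]_theta (f_ k theta)%:E @[k --> \oo]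
    --> \int[prior pin g]_theta f theta.
  rewrite (_ : \int[prior pin g]_theta f theta =
     \int[prior pin g]_theta (limn (fun k => (f_ k theta)%:E))); last first.
    by apply: eq_integral => t _; apply/esym/cvg_lim.
  apply: cvg_monotone_convergence => //.
    by move=> k; exact/measurable_EFinP/measurable_funP.
  by move=> k t _; rewrite lee_fin.
rewrite -(cvg_lim _ cvl)//; apply/cvg_lim => //.
under eq_fun do rewrite integral_prior_nnsfun.
apply: cvg_nnesum => S _.
  apply: nearW => k; rewrite mule_ge0 ?lee_fin ?prior_weight_ge0//.
  by apply: integral_ge0 => x _; rewrite mule_ge0// lee_fin ?dens_ge0.
apply: cvgeZl => //.
rewrite (_ : \int[_]_x (f _ * _) = \int[lebesgue_vec R #|S|]_x
   (limn (fun k => (f_ k (vembed x))%:E * (g #|S| x)%:E))); last first.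
  by apply: eq_integral => t _; apply/esym/cvg_lim => //; exact: cvgeZr.
apply: cvg_monotone_convergence => //.
- move=> k; apply/measurable_EFinP/measurable_funM; last exact: measurable_dens.
  apply: (@measurableT_comp _ _ _ _ _ _ (f_ k)); first exact: measurable_funP.
  exact: measurable_vembed.
- by move=> k t _; rewrite mule_ge0// lee_fin ?dens_ge0.
- move=> t _ m m' mm'; apply: lee_wpmul2r; first by rewrite lee_fin dens_ge0.
  exact: nd.
Qed.

End integral_prior.

(** * Gaussian integrals and integrals of products over coordinates *)

Section gaussian_integrals.
Context (R : realType).
Local Notation mu := (@lebesgue_measure R).

Lemma normal_pdf1E (m x : R) :
  normal_pdf m 1 x = (Num.sqrt (2 * pi))^-1 * expR (- ((x - m) ^+ 2 / 2)).
Proof.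
by rewrite /normal_pdf oner_eq0 /normal_peak /normal_fun expr1n mul1r mulNr
  -mulr_natl.
Qed.

Lemma normal_pdf1_gt0 (m x : R) : 0 < normal_pdf m 1 x.
Proof.
by rewrite normal_pdf1E mulr_gt0 ?expR_gt0// invr_gt0 sqrtr_gt0 mulr_gt0 ?pi_gt0.
Qed.

Lemma normal_pdf1_sym (m x : R) : normal_pdf m 1 x = normal_pdf x 1 m.
Proof. by rewrite !normal_pdf1E -[X in X / 2]sqrrN opprB. Qed.

Lemma measurable_normal_pdf_mean (x : R) :
  measurable_fun setT (fun m : R => normal_pdf m 1 x).
Proof.
rewrite (_ : (fun m => _) = normal_pdf x 1); first exact: measurable_normal_pdf.
by apply/funext => m; exact: normal_pdf1_sym.
Qed.

Lemma measurable_expR_quad (k t c m : R) :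
  measurable_fun setT (fun x : R => expR (c + t * (x - m) - k * (x - m) ^+ 2)).
Proof.
have mB : measurable_fun setT (fun x : R => x - m) by exact: measurable_funB.
apply: measurableT_comp => //; apply: measurable_funB.
  by apply: measurable_funD => //; exact: measurable_funM.
by apply: measurable_funM => //; exact: measurable_funX.
Qed.

(** Completing the square turns the integrand into a multiple of the normal density with mean m + t
    / (2 k) and variance 1 / (2 k). *)
Lemma integral_expR_quad (k t c m : R) : 0 < k ->
  (\int[mu]_x (expR (c + t * (x - m) - k * (x - m) ^+ 2))%:E =
   (Num.sqrt (pi / k) * expR (c + t ^+ 2 / (4 * k)))%:E)%E.
Proof.
move=> k0; pose s : R := Num.sqrt (2 * k)^-1.
have s2 : s ^+ 2 = (2 * k)^-1 by rewrite sqr_sqrtr// invr_ge0 mulr_ge0// ltW.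
have s0 : s != 0.
  by rewrite -sqrf_eq0 s2 invr_eq0 mulf_neq0// gt_eqF.
set C := Num.sqrt _ * _.
have C0 : 0 <= C by rewrite mulr_ge0 ?sqrtr_ge0 ?expR_ge0.
transitivity (\int[mu]_x (C%:E * (normal_pdf (m + t / (2 * k)) s x)%:E))%E.
  apply: eq_integral => x _; rewrite -EFinM; congr EFin.
  rewrite normal_pdfE// /normal_peak /normal_fun s2 /C.
  have -> : (2 * k)^-1 * pi *+ 2 = pi / k :> R by field; rewrite gt_eqF.
  rewrite mulrACA divff; last by rewrite gt_eqF// sqrtr_gt0 divr_gt0// pi_gt0.
  rewrite mul1r -expRD; congr expR; field.
  by rewrite gt_eqF.
rewrite ge0_integralZl//=.
- by rewrite integral_normal_pdf mule1.
- by apply/measurable_EFinP; exact: measurable_normal_pdf.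
- by move=> x _; rewrite lee_fin normal_pdf_ge0.
Qed.

(** Induction on n: the measure on the space of dimension n + 1 is the image of a product measure
    under [vcons], so Tonelli splits off the first coordinate. *)
Lemma integral_lebesgue_vec_prod n (f : 'I_n -> R -> R) (v : 'I_n -> R) :
  (forall i, measurable_fun setT (f i)) -> (forall i x, 0 <= f i x) ->
  (forall i, \int[mu]_x (f i x)%:E = (v i)%:E)%E ->
  (\int[lebesgue_vec R n]_x (\prod_(i < n) f i (tnth x i))%:E =
   (\prod_(i < n) v i)%:E)%E.
Proof.
elim: n f v => [|n IH] f v mf f0 fv.
  rewrite /= big_ord0; under eq_integral do rewrite big_ord0.
  by rewrite integral_cst//= diracT mul1e.
have v0 i : 0 <= v i.
  by rewrite -lee_fin -fv; apply: integral_ge0 => x _; rewrite lee_fin.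
have mprod k (h : 'I_k -> R -> R) : (forall i, measurable_fun setT (h i)) ->
    measurable_fun setT (fun x : vec R k => \prod_(i < k) h i (tnth x i)).
  move=> mh; apply: measurable_prod => i _.
  exact: (measurableT_comp (mh i) (measurable_tnth i)).
rewrite /= ge0_integral_pushforward//=; last 3 first.
- exact: measurable_vcons.
- by apply/measurable_EFinP; exact: mprod.
- by move=> x _; rewrite lee_fin prodr_ge0.
rewrite preimage_setT.
have prodE z : \prod_(i < n.+1) f i (tnth (vcons z) i) =
    f ord0 z.1 * \prod_(i < n) f (lift ord0 i) (tnth z.2 i).
  rewrite big_ord_recl; congr (_ * _).
  by apply: eq_bigr => i _; rewrite /vcons tnthS.
under eq_integral do rewrite /= prodE.
rewrite (@fubini_tonelli1 _ _ _ _ _ (@lebesgue_measure R)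
  (lebesgue_vec R n))/=; last 2 first.
- apply/measurable_EFinP; apply: measurable_funM.
    exact: (measurableT_comp (mf _) measurable_fst).
  exact: (measurableT_comp (mprod _ (fun i => f (lift ord0 i)) _) measurable_snd).
- by move=> x; rewrite lee_fin mulr_ge0 ?prodr_ge0.
rewrite /fubini_F/=.
transitivity (\int[mu]_x ((f ord0 x)%:E * (\prod_(i < n) v (lift ord0 i))%:E))%E.
  apply: eq_integral => x _.
  rewrite -(IH (fun i => f (lift ord0 i)))// -ge0_integralZl//=.
  - by apply/measurable_EFinP; exact: (mprod _ (fun i => f (lift ord0 i))).
  - by move=> y _; rewrite lee_fin prodr_ge0.
  - by rewrite lee_fin.
rewrite ge0_integralZr//=.
- by rewrite fv -EFinM big_ord_recl.
- by apply/measurable_EFinP; exact: mf.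
- by move=> x _; rewrite lee_fin.
- by rewrite lee_fin prodr_ge0.
Qed.

Lemma integral_lebesgue_vec_prod_le n (f : 'I_n -> R -> R) (v : 'I_n -> R) :
  (forall i, measurable_fun setT (f i)) -> (forall i x, 0 <= f i x) ->
  (forall i, \int[mu]_x (f i x)%:E <= (v i)%:E)%E ->
  (\int[lebesgue_vec R n]_x (\prod_(i < n) f i (tnth x i))%:E <=
   (\prod_(i < n) v i)%:E)%E.
Proof.
move=> mf f0 fv; have if0 i : (0 <= \int[mu]_x (f i x)%:E)%E.
  by apply: integral_ge0 => x _; rewrite lee_fin.
have fE i : (\int[mu]_x (f i x)%:E = (fine (\int[mu]_x (f i x)%:E))%:E)%E.
  by rewrite fineK// ge0_fin_numE// (le_lt_trans (fv i)) ?ltry.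
rewrite (integral_lebesgue_vec_prod mf f0 fE) lee_fin; apply: ler_prod => i _.
by rewrite fine_ge0//= -lee_fin -fE.
Qed.

End gaussian_integrals.

(** * Products over the coordinates of an embedded vector *)

Section vembed_products.
Context (R : realType).

Lemma tnth_vembed_notin n (S : {set 'I_n}) (x : vec R #|S|) i :
  i \notin S -> tnth (vembed x) i = 0.
Proof.
move=> iS; rewrite tnth_mktuple nth_default// size_tuple.
by rewrite memNindex ?mem_enum// -cardE.
Qed.

Lemma tnth_vembed_enum_val n (S : {set 'I_n}) (x : vec R #|S|) j :
  tnth (vembed x) (enum_val j) = tnth x j.
Proof. by rewrite -[in RHS](vembedK x) [RHS]tnth_mktuple. Qed.

Lemma tnth_vembed_vproj n (S : {set 'I_n}) (x : vec R n) i :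
  tnth (vembed (vproj S x)) i = if i \in S then tnth x i else 0.
Proof.
case: ifPn => [iS|]; last exact: tnth_vembed_notin.
by rewrite -(enum_rankK_in iS iS) tnth_vembed_enum_val tnth_mktuple.
Qed.

Lemma prod_vembed n (S : {set 'I_n}) (f : 'I_n -> R -> R) (x : vec R #|S|) :
  \prod_(i < n) f i (tnth (vembed x) i) =
  (\prod_(i | i \notin S) f i 0) *
  \prod_(j < #|S|) f (enum_val j) (tnth x j).
Proof.
rewrite (bigID (mem S))/= mulrC; congr (_ * _).
  by apply: eq_bigr => i iS; rewrite tnth_vembed_notin.
rewrite big_enum_val/=; apply: eq_bigr => j _.
  by rewrite tnth_vembed_enum_val.
Qed.

(** An embedded vector is pinned at 0 outside S, so such a coordinate contributes the value of its
    factor at 0 in place of an integral. *)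
Lemma integral_prod_vembed n (S : {set 'I_n}) (f : 'I_n -> R -> R)
    (v : 'I_n -> R) :
  (forall i, measurable_fun setT (f i)) -> (forall i x, 0 <= f i x) ->
  (forall i, i \in S ->
    \int[@lebesgue_measure R]_x (f i x)%:E = (v i)%:E)%E ->
  (\int[lebesgue_vec R #|S|]_x (\prod_(i < n) f i (tnth (vembed x) i))%:E =
   (\prod_(i < n) if i \in S then v i else f i 0)%:E)%E.
Proof.
move=> mf f0 fv; under eq_integral do rewrite prod_vembed EFinM.
rewrite ge0_integralZl//=; last 3 first.
- apply/measurable_EFinP; apply: measurable_prod => j _.
  exact: (measurableT_comp (mf _) (measurable_tnth j)).
- by move=> x _; rewrite lee_fin prodr_ge0.
- by rewrite lee_fin prodr_ge0.
rewrite (@integral_lebesgue_vec_prod _ _ (fun j => f (enum_val j))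
   (fun j => v (enum_val j)))//; last by move=> j; rewrite fv// enum_valP.
rewrite -EFinM [in RHS](bigID (mem S))/= mulrC; congr (_ * _)%:E.
  by rewrite -big_enum_val/=; apply: eq_bigr => i ->.
by apply: eq_bigr => i /negbTE ->.
Qed.

End vembed_products.

(** * The contribution of a single coordinate *)

Section coordinates.
Context (R : realType).
Local Notation mu := (@lebesgue_measure R).
Implicit Types m u x : R.

(* Relative to the density of N(u, 1): the density of N(t, 1), weighted by
   exp((t - u)^2 / 64 + 3/32 (t - m)^2), integrated over t, resp. taken at
   t = 0. *)
Definition free_ratio m u x : R :=
  Num.sqrt (64 * pi / 25) *
  expR ((m - u) ^+ 2 / 64 - (x - m) ^+ 2 / 2
        + 16 / 25 * ((m - u) / 32 + (x - m)) ^+ 2 + (x - u) ^+ 2 / 2).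

Definition null_ratio m u x : R :=
  expR (u ^+ 2 / 64 + 3 / 32 * m ^+ 2 - x ^+ 2 / 2 + (x - u) ^+ 2 / 2).

(** As a polynomial in t - m the exponent has leading coefficient 1/64 + 3/32 - 1/2 = - 25/64,
    whence the constants 64/25 and 16/25 of [free_ratio]. *)
Lemma integral_free m u x :
  (\int[mu]_t (expR ((t - u) ^+ 2 / 64 + 3 / 32 * (t - m) ^+ 2)
     * normal_pdf t 1 x)%:E = (free_ratio m u x * normal_pdf u 1 x)%:E)%E.
Proof.
transitivity (\int[mu]_t ((Num.sqrt (2 * pi))^-1%:E *
  (expR ((m - u) ^+ 2 / 64 - (x - m) ^+ 2 / 2
        + ((m - u) / 32 + (x - m)) * (t - m) - 25 / 64 * (t - m) ^+ 2))%:E))%E.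
  apply: eq_integral => t _; rewrite normal_pdf1E -EFinM; congr EFin.
  by rewrite mulrCA -expRD; congr (_ * expR _); field.
rewrite ge0_integralZl//=; last first.
  by apply/measurable_EFinP; exact: measurable_expR_quad.
rewrite integral_expR_quad// -EFinM; congr EFin.
rewrite /free_ratio normal_pdf1E mulrA [RHS]mulrACA -expRD [X in X * _]mulrC.
congr (_ / _ * expR _); last by field.
by congr Num.sqrt; field.
Qed.

Lemma null_ratioE m u x :
  expR ((0 - u) ^+ 2 / 64 + 3 / 32 * (0 - m) ^+ 2) * normal_pdf 0 1 x =
  null_ratio m u x * normal_pdf u 1 x.
Proof.
rewrite /null_ratio !normal_pdf1E mulrCA [RHS]mulrCA -!expRD.
by congr (_ * expR _); field.
Qed.

(** Serves the lower bound on the denominator. Here the leading coefficient in t - u is - 1/64 - 1/2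
    = - 33/64. *)
Lemma integral_shrunk u x :
  (\int[mu]_t (expR (- ((t - u) ^+ 2 / 64)) * normal_pdf t 1 x)%:E =
   (Num.sqrt (64 * pi / 33) * expR (16 / 33 * (x - u) ^+ 2)
     * normal_pdf u 1 x)%:E)%E.
Proof.
transitivity (\int[mu]_t ((Num.sqrt (2 * pi))^-1%:E *
  (expR (- ((x - u) ^+ 2 / 2) + (x - u) * (t - u) - 33 / 64 * (t - u) ^+ 2))%:E))%E.
  apply: eq_integral => t _; rewrite normal_pdf1E -EFinM; congr EFin.
  by rewrite mulrCA -expRD; congr (_ * expR _); field.
rewrite ge0_integralZl//=; last first.
  by apply/measurable_EFinP; exact: measurable_expR_quad.
rewrite integral_expR_quad// -EFinM; congr EFin.
rewrite normal_pdf1E mulrA [RHS]mulrACA -expRD [X in X * _]mulrC.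
congr (_ / _ * expR _); last by field.
by congr Num.sqrt; field.
Qed.

Lemma shrunk_ge u x :
  normal_pdf u 1 x <=
  Num.sqrt (64 * pi / 33) * expR (16 / 33 * (x - u) ^+ 2) * normal_pdf u 1 x.
Proof.
rewrite ler_peMl ?normal_pdf_ge0// -[leLHS]mulr1 ler_pM//.
- rewrite -[leLHS]sqrtr1 ler_wsqrtr//; have := @pi_ge2 R; lra.
- by rewrite -expR0 ler_expR mulr_ge0 ?sqr_ge0.
Qed.

Lemma sqrtr_expR (y : R) : Num.sqrt (expR y) = expR (y / 2).
Proof.
by rewrite [in LHS](splitr y) expRD -expr2 sqrtr_sqr ger0_norm ?expR_ge0.
Qed.

(** The form of r is adapted to the square root: halving the exponent leaves (x - m)^2 / 2, which
    cancels the exponent of the normal density and leaves a pure quadratic. *)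
Let integral_sqrt_ratio_quad (A k t c m : R) (r : R -> R) : 0 <= A -> 0 < k ->
  (forall x, r x = A * expR (2 * (c + t * (x - m) - k * (x - m) ^+ 2)
                             + (x - m) ^+ 2)) ->
  (\int[mu]_x (Num.sqrt (r x) * normal_pdf m 1 x)%:E =
  (Num.sqrt A / Num.sqrt (2 * k) * expR (c + t ^+ 2 / (4 * k)))%:E)%E.
Proof.
move=> A0 k0 rE.
transitivity (\int[mu]_x ((Num.sqrt A / Num.sqrt (2 * pi))%:E *
  (expR (c + t * (x - m) - k * (x - m) ^+ 2))%:E))%E.
  apply: eq_integral => x _; rewrite -EFinM; congr EFin.
  rewrite rE sqrtrM// sqrtr_expR normal_pdf1E mulrACA -expRD.
  by congr (_ * expR _); field.
rewrite ge0_integralZl//=; last first.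
  by apply/measurable_EFinP; exact: measurable_expR_quad.
rewrite integral_expR_quad// -EFinM mulrA; congr (_ * _)%:E.
rewrite -!mulrA; congr (_ * _).
rewrite -!sqrtrV ?mulr_ge0 ?pi_ge0 ?(ltW k0)// -sqrtrM ?invr_ge0 ?mulr_ge0 ?pi_ge0//.
congr Num.sqrt; move: (@pi_gt0 R); move: (@pi R) => p p0.
by field; rewrite !gt_eqF.
Qed.

(** The exact exponent is (413/1600 + 169/450) (m - u)^2, with coefficient below 1; the exact
    prefactor is below 4 because pi < 4. *)
Lemma integral_sqrt_free m u :
  (\int[mu]_x (Num.sqrt (free_ratio m u x) * normal_pdf m 1 x)%:E <=
   (4 * expR ((m - u) ^+ 2))%:E)%E.
Proof.
(* The coefficients come from expanding the exponent of [free_ratio] in x - m, with x - u = (x - m)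
   + (m - u). *)
rewrite (@integral_sqrt_ratio_quad (Num.sqrt (64 * pi / 25)) (9 / 50)
  (13 / 25 * (m - u)) (413 / 1600 * (m - u) ^+ 2))//; last first.
- by move=> x; congr (_ * expR _); field.
rewrite lee_fin ler_pM ?mulr_ge0 ?invr_ge0 ?expR_ge0//; last first.
  by rewrite ler_expR; have := sqr_ge0 (m - u); lra.
rewrite -sqrtrV// -sqrtrM//.
have p4 : 64 * pi / 25 <= 4 ^+ 2 :> R by have := @pihalf_lt2 R; lra.
have : Num.sqrt (64 * pi / 25) <= 4 :> R.
  by rewrite -[leRHS]ger0_norm// -sqrtr_sqr ler_wsqrtr.
by move=> h; rewrite -[leRHS]ger0_norm// -sqrtr_sqr ler_wsqrtr//; lra.
Qed.

(** The two cases are a coordinate inside S0 and one outside it. For u = m, setting the coordinate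
    to 0 costs likelihood, and the exponent is - 9/128 m^2; for u = 0 the likelihoods agree, and
    only the inserted weight remains, giving 3/64 m^2. *)
Lemma integral_sqrt_null m u : u = m \/ u = 0 ->
  (\int[mu]_x (Num.sqrt (null_ratio m u x) * normal_pdf m 1 x)%:E <=
   (expR ((m - u) ^+ 2))%:E)%E.
Proof.
have c1 : Num.sqrt 1 / Num.sqrt (2 * (1 / 2)) = 1 :> R.
  by rewrite div1r mulfV// sqrtr1 divr1.
case=> ->.
- rewrite (@integral_sqrt_ratio_quad 1 (1 / 2) (- m / 2) (- 25 / 128 * m ^+ 2))//.
  + by rewrite lee_fin c1 [leLHS]mul1r ler_expR; have := sqr_ge0 m; lra.
  + by move=> x; rewrite [RHS]mul1r; congr expR; field.
- rewrite (@integral_sqrt_ratio_quad 1 (1 / 2) 0 (3 / 64 * m ^+ 2))//.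
  + by rewrite lee_fin c1 [leLHS]mul1r ler_expR; have := sqr_ge0 m; lra.
  + by move=> x; rewrite [RHS]mul1r; congr expR; field.
Qed.

Lemma measurable_free_ratio m u :
  measurable_fun setT (fun x => free_ratio m u x).
Proof.
rewrite /free_ratio; apply: measurable_funM => //; apply: measurableT_comp => //.
rewrite (_ : (fun x => _) = (fun x => (m - u) ^+ 2 / 64
  - (x - m) * (x - m) / 2 +  16 / 25 * (((m - u) / 32 + (x - m)) *
  ((m - u) / 32 + (x - m))) + (x - u) * (x - u) / 2)); last first.
  by apply/funext => x; rewrite !expr2.
by do ?[exact: measurable_cst | exact: measurable_id | apply: measurable_funM |
  apply: measurable_funB | apply: measurable_funD].
Qed.

Lemma measurable_null_ratio m u :
  measurable_fun setT (fun x => null_ratio m u x).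
Proof.
rewrite /null_ratio; apply: measurableT_comp => //.
rewrite (_ : (fun x => _) = (fun x => u ^+ 2 / 64 + 3 / 32 * m ^+ 2
   - x * x / 2 + (x - u) * (x - u) / 2)); last first.
  by apply/funext => x; rewrite !expr2.
by do ?[exact: measurable_cst | exact: measurable_id | apply: measurable_funM |
  apply: measurable_funB | apply: measurable_funD].
Qed.

End coordinates.

(** * Norms on subsets of coordinates, and measurability *)

Section norms.
Context (R : realType).

Lemma l2norm_sqr n (x : vec R n) : l2norm x ^+ 2 = \sum_(i < n) tnth x i ^+ 2.
Proof. by rewrite sqr_sqrtr// sumr_ge0// => i _; exact: sqr_ge0. Qed.

Lemma l2dist_sqr n (x y : vec R n) :
  l2dist x y ^+ 2 = \sum_(i < n) (tnth x i - tnth y i) ^+ 2.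
Proof. by rewrite l2norm_sqr; apply: eq_bigr => i _; rewrite tnth_mktuple. Qed.

Lemma l2norm_vproj_sqr n (S : {set 'I_n}) (x : vec R n) :
  l2norm (vproj S x) ^+ 2 = \sum_(i in S) tnth x i ^+ 2.
Proof.
rewrite l2norm_sqr [RHS]big_enum_val/=.
by apply: eq_bigr => j _; rewrite tnth_mktuple.
Qed.

Lemma l2dist_vproj_sqr n (S : {set 'I_n}) (x y : vec R n) :
  l2dist (vproj S x) (vproj S y) ^+ 2 =
  \sum_(i in S) (tnth x i - tnth y i) ^+ 2.
Proof.
rewrite l2dist_sqr [RHS]big_enum_val/=.
by apply: eq_bigr => j _; rewrite !tnth_mktuple.
Qed.

Lemma l2dist_vembed_sqr n (S : {set 'I_n}) (x y : vec R #|S|) :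
  l2dist x y ^+ 2 = l2dist (vembed x) (vembed y) ^+ 2.
Proof.
rewrite -[in LHS](vembedK x) -[in LHS](vembedK y) l2dist_vproj_sqr l2dist_sqr.
rewrite [RHS](bigID (mem S))/= [X in _ + X]big1 ?addr0// => i iS.
by rewrite !tnth_vembed_notin// subrr expr0n.
Qed.

Lemma measurable_sqrtr : measurable_fun setT (@Num.sqrt R).
Proof. by apply: continuous_measurable_fun; exact: sqrt_continuous. Qed.

Lemma measurable_l2dist n (y : vec R n) :
  measurable_fun setT (fun x : vec R n => l2dist x y).
Proof.
rewrite (_ : (fun x => _) =
  (fun x : vec R n => Num.sqrt (\sum_(i < n) (tnth x i - tnth y i) ^+ 2))).
  apply: (measurableT_comp measurable_sqrtr); apply: measurable_sum => i.
  apply: measurable_funX; apply: measurable_funB; last exact: measurable_cst.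
  exact: measurable_tnth.
apply/funext => x; rewrite /l2dist /l2norm; congr Num.sqrt.
by apply: eq_bigr => i _; rewrite tnth_mktuple.
Qed.

Lemma measurable_gauss_dens_mean n (x : vec R n) :
  measurable_fun setT (fun theta : vec R n => gauss_dens theta x).
Proof.
apply: measurable_prod => i _.
exact: (measurableT_comp (measurable_normal_pdf_mean _) (measurable_tnth i)).
Qed.

Lemma gauss_dens_gt0 n (theta x : vec R n) : 0 < gauss_dens theta x.
Proof. by apply: prodr_gt0 => i _; exact: normal_pdf1_gt0. Qed.

End norms.

(** * Comparison of the prior densities across subsets *)

Section density_comparison.
Context (R : realType) (n : nat) (g : forall p : nat, density R p) (c1 : R).
Hypothesis smooth_g : forall (S : {set 'I_n}) (x y : vec R #|S|),
  (lne (g #|S| x)%:E - lne (g #|S| y)%:E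
     <= (c1 * #|S|%:R + 1 / 64%:R * l2dist x y ^+ 2)%:E)%E.
Hypothesis nested_g : forall (S S' : {set 'I_n}), S' \subset S ->
  forall x : vec R #|S|,
  (`|lne (g #|S| x)%:E - lne (g #|S'| (vproj S' (vembed x)))%:E|
     <= (c1 * #|S|%:R
         + 1 / 64%:R * l2norm (vproj (S :\: S') (vembed x)) ^+ 2)%:E)%E.

(** Since [lne] is -oo at 0, one zero of the density would make the smoothness bound fail at every
    point of positive density; the density would then vanish everywhere, against its integral being
    1. From here on, real logarithms suffice. *)
Lemma smooth_dens_gt0 (S : {set 'I_n}) (x : vec R #|S|) : 0 < g #|S| x.
Proof.
rewrite lt_neqAle dens_ge0 andbT; apply/negP => /eqP gx0.
suff gy0 y : g #|S| y = 0.
  have := integral_dens (g #|S|); under eq_integral do rewrite gy0.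
  by rewrite integral0 => -[/esym/eqP]; rewrite oner_eq0.
apply/eqP; rewrite eq_le dens_ge0 andbT leNgt; apply/negP => gy.
have := smooth_g y x; rewrite -gx0 lne_EFin//.
by rewrite (_ : lne 0%:E = -oo%E) ?le0_lneNy.
Qed.

Lemma smooth_ln (S : {set 'I_n}) (x y : vec R #|S|) :
  ln (g #|S| x) <= ln (g #|S| y) + c1 * #|S|%:R + 1 / 64 * l2dist x y ^+ 2.
Proof.
have := smooth_g x y; rewrite !lne_EFin ?smooth_dens_gt0// -EFinB lee_fin; lra.
Qed.

Lemma nested_ln (S S' : {set 'I_n}) (x : vec R #|S|) : S' \subset S ->
  `|ln (g #|S| x) - ln (g #|S'| (vproj S' (vembed x)))| <=
  c1 * #|S|%:R + 1 / 64 * \sum_(i in S :\: S') tnth (vembed x) i ^+ 2.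
Proof.
move=> S'S; have := nested_g S'S x.
by rewrite !lne_EFin ?smooth_dens_gt0// -EFinB lee_fin l2norm_vproj_sqr.
Qed.

Hypothesis c1_ge0 : 0 <= c1.

(* Going from S to S' through S :&: S' spends each coordinate of the difference
   of the embedded vectors exactly once. *)
Lemma dens_le (S S' : {set 'I_n}) (x : vec R #|S|) (y : vec R #|S'|) :
  g #|S| x <= g #|S'| y * expR (c1 * (#|S|%:R + 2 * #|S'|%:R) +
    1 / 64 * l2dist (vembed x) (vembed y) ^+ 2).
Proof.
rewrite -[leLHS]lnK ?posrE ?smooth_dens_gt0//.
rewrite -[X in X * _]lnK ?posrE ?smooth_dens_gt0// -expRD ler_expR.
pose T := S :&: S'.
(* [h1] restricts x from S to T, [h3] extends y from T to S', and [h2] moves from x to y within T.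
   Their costs c1 |S|, c1 |S'| and c1 |T| <= c1 |S'| add up to the constant of the statement. *)
have := nested_ln x (subsetIl S S'); rewrite -/T ler_distl => /andP[_ h1].
have := nested_ln y (subsetIr S S'); rewrite -/T ler_distl => /andP[h3 _].
have h2 := @smooth_ln T (vproj T (vembed x)) (vproj T (vembed y)).
have cT : c1 * #|T|%:R <= c1 * #|S'|%:R.
  by rewrite ler_wpM2l// ler_nat subset_leq_card// subsetIr.
have dE : l2dist (vembed x) (vembed y) ^+ 2 =
    \sum_(i in T) (tnth (vembed x) i - tnth (vembed y) i) ^+ 2 +
    \sum_(i in S :\: T) tnth (vembed x) i ^+ 2 +
    \sum_(i in S' :\: T) tnth (vembed y) i ^+ 2.
  rewrite l2dist_sqr (bigID (mem T))/= -addrA; congr (_ + _).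
  rewrite (bigID (mem S))/= ; congr (_ + _).
    rewrite [RHS](eq_bigl (fun i => (i \notin T) && (i \in S))); last first.
      by move=> i; rewrite !inE.
    apply: eq_bigr => i; rewrite !inE => /andP[iT iS].
    by rewrite (@tnth_vembed_notin _ _ _ y) ?subr0//; move: iT; rewrite iS.
  rewrite (bigID (mem S'))/= [X in _ + X]big1 ?addr0; last first.
    move=> i /andP[/andP[_ iS] iS'].
    by rewrite !tnth_vembed_notin// subrr expr0n.
  apply: eq_big => i; first by rewrite !inE; case: (i \in S); case: (i \in S').
  by move=> /andP[/andP[_ iS] _]; rewrite tnth_vembed_notin// sub0r sqrrN.
move: h2; rewrite l2dist_vproj_sqr dE; lra.
Qed.

End density_comparison.

(** * Bound on the expected posterior probability by a sum over subsets *)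

Lemma prod_expR (R : realType) (I : Type) (r : seq I) (f : I -> R) :
  \prod_(i <- r) expR (f i) = expR (\sum_(i <- r) f i).
Proof. by rewrite (big_morph _ (@expRD R) (@expR0 R)). Qed.

Lemma sqrtr_prod (R : realType) (I : Type) (r : seq I) (f : I -> R) :
  (forall i, 0 <= f i) ->
  Num.sqrt (\prod_(i <- r) f i) = \prod_(i <- r) Num.sqrt (f i).
Proof.
move=> f0; elim: r => [|i r IH]; first by rewrite !big_nil sqrtr1.
by rewrite !big_cons sqrtrM// IH.
Qed.

(** As z <= d, the quotient lies in [0, 1] and is at most its square root, which grows when z is
    replaced by a and d by b. An infinite d is allowed: the quotient is then 0. *)
Lemma dive_le_sqrt (R : realType) (z d : \bar R) (a b : R) :
  (0 <= z)%E -> (z <= d)%E -> (z <= a%:E)%E -> 0 < b -> (b%:E <= d)%E ->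
  (z / d <= (Num.sqrt (a / b))%:E)%E.
Proof.
case: d => [d| |]; last by move=> _ _ _ _; rewrite leeNy_eq.
  case: z => [z| |]//; rewrite !lee_fin => z0 zd za b0 bd.
  have d0 : 0 < d by exact: lt_le_trans bd.
  rewrite inver gt_eqF// -EFinM lee_fin.
  have zd1 : z / d <= 1 by rewrite ler_pdivrMr// mul1r.
  have zd0 : 0 <= z / d by rewrite divr_ge0// ltW.
  apply: (@le_trans _ _ (Num.sqrt (z / d))).
    by rewrite -[leLHS]ger0_norm// -sqrtr_sqr ler_wsqrtr// expr2 ler_piMl.
  rewrite ler_wsqrtr// ler_pM ?invr_ge0 ?(ltW d0)//.
  by rewrite lef_pV2 ?posrE.
by move=> _ _ _ _ _; rewrite invey mule0 lee_fin sqrtr_ge0.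
Qed.

Section posterior_bound.
Context (R : realType) (n : nat) (pin : dim_prior R n)
  (g : forall p : nat, density R p) (c1 : R).
Hypothesis smooth_g : forall (S : {set 'I_n}) (x y : vec R #|S|),
  (lne (g #|S| x)%:E - lne (g #|S| y)%:E
     <= (c1 * #|S|%:R + 1 / 64%:R * l2dist x y ^+ 2)%:E)%E.
Hypothesis nested_g : forall (S S' : {set 'I_n}), S' \subset S ->
  forall x : vec R #|S|,
  (`|lne (g #|S| x)%:E - lne (g #|S'| (vproj S' (vembed x)))%:E|
     <= (c1 * #|S|%:R
         + 1 / 64%:R * l2norm (vproj (S :\: S') (vembed x)) ^+ 2)%:E)%E.
Hypothesis c1_ge0 : 0 <= c1.
Variables (theta0 : vec R n) (S0 : {set 'I_n}) (M : R).
Hypothesis M_ge0 : 0 <= M.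

Let y0 : vec R #|S0| := vproj S0 theta0.
Let u : vec R n := vembed y0.
Let far : set (vec R n) := [set theta | M < l2dist theta theta0].

Definition coord_ratio (b : bool) (m v x : R) : R :=
  if b then free_ratio m v x else null_ratio m v x.

Lemma coord_ratio_ge0 b m v x : 0 <= coord_ratio b m v x.
Proof. by case: b; rewrite ?mulr_ge0 ?expR_ge0. Qed.

Let ratio (S : {set 'I_n}) i (x : R) : R :=
  coord_ratio (i \in S) (tnth theta0 i) (tnth u i) x.

Let measurable_ratio S i : measurable_fun setT (ratio S i).
Proof.
rewrite /ratio /coord_ratio; case: (i \in S); first exact: measurable_free_ratio.
exact: measurable_null_ratio.
Qed.

Let weight (S : {set 'I_n}) : R := pin #|S| / 'C(n, #|S|)%:R.

Let weight_gt0 S : 0 < weight S.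
Proof.
have Sn : (#|S| <= n)%N by rewrite -[leqRHS]card_ord max_card.
by rewrite divr_gt0 ?dimp_gt0// ltr0n bin_gt0.
Qed.

Let likelihood (x : vec R n) (theta : vec R n) : \bar R := (gauss_dens theta x)%:E.

Let likelihood_ge0 x theta : (0 <= likelihood x theta)%E.
Proof. by rewrite lee_fin ltW ?gauss_dens_gt0. Qed.

(** After [dens_le] and the insertion of the weight exp(3/32 (|theta - theta0|^2 - M^2)), the
    integrand is a constant times a product of the factors f i below. Coordinates in S are
    integrated by [integral_free]; the others sit at 0 and give [null_ratio]. *)
Lemma numerator_le (S : {set 'I_n}) (x : vec R n) :
  (\int[lebesgue_vec R #|S|]_t
     ((likelihood x \_ far) (vembed t) * (g #|S| t)%:E) <=
   (g #|S0| y0 * expR (c1 * (#|S|%:R + 2 * #|S0|%:R) - 3 / 32 * M ^+ 2) *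
     ((\prod_(i < n) ratio S i (tnth x i)) * gauss_dens u x))%:E)%E.
Proof.
set C := g _ _ * _.
have C0 : 0 <= C by rewrite mulr_ge0 ?expR_ge0 ?dens_ge0.
pose f i t := expR ((t - tnth u i) ^+ 2 / 64 + 3 / 32 * (t - tnth theta0 i) ^+ 2)
  * normal_pdf t 1 (tnth x i).
have mf i : measurable_fun setT (f i).
  apply: measurable_funM; last exact: measurable_normal_pdf_mean.
  apply: measurableT_comp => //; apply: measurable_funD.
    apply: measurable_funM; last exact: measurable_cst.
    by apply: measurable_funX; exact: measurable_funB.
  apply: measurable_funM; first exact: measurable_cst.
  by apply: measurable_funX; exact: measurable_funB.
have f0 i t : 0 <= f i t by rewrite mulr_ge0 ?expR_ge0 ?normal_pdf_ge0.
apply: (@le_trans _ _ (\int[lebesgue_vec R #|S|]_t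
    (C%:E * (\prod_(i < n) f i (tnth (vembed t) i))%:E)))%E.
  apply: ge0_le_integralT => t.
    rewrite mule_ge0 ?lee_fin ?dens_ge0//.
    by rewrite patchE; case: ifP.
  rewrite patchE; case: ifPn => [|_]; last first.
    by rewrite mul0e -EFinM lee_fin mulr_ge0 ?prodr_ge0.
  rewrite inE /far/= => Mt; rewrite /likelihood -!EFinM lee_fin.
  rewrite /f big_split/= prod_expR mulrA mulrC -/(gauss_dens _ _).
  rewrite ler_wpM2r ?(ltW (gauss_dens_gt0 _ _))//.
  apply: (le_trans (dens_le smooth_g nested_g c1_ge0 t y0)).
  rewrite /C -[leRHS]mulrA -expRD ler_wpM2l ?dens_ge0// ler_expR -/u.
  rewrite big_split/= -mulr_suml -mulr_sumr -!l2dist_sqr.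
  (* Membership in [far] makes the exponent of the inserted weight nonnegative. *)
  have : M ^+ 2 <= l2dist (vembed t) theta0 ^+ 2.
    by rewrite lerXn2r ?nnegrE ?(ltW Mt) ?sqrtr_ge0.
  lra.
rewrite ge0_integralZl//=; last 2 first.
- apply/measurable_EFinP; apply: measurable_prod => i _.
  apply: (measurableT_comp (mf i)).
  exact: (measurableT_comp (measurable_tnth i) (@measurable_vembed _ _ S)).
- by move=> t _; rewrite lee_fin prodr_ge0.
rewrite (@integral_prod_vembed _ _ S f
  (fun i => free_ratio (tnth theta0 i) (tnth u i) (tnth x i)
            * normal_pdf (tnth u i) 1 (tnth x i)))//; last first.
  by move=> i _; exact: integral_free.
rewrite -EFinM lee_fin ler_wpM2l// /gauss_dens -big_split/=.
rewrite le_eqVlt; apply/orP; left; apply/eqP; apply: eq_bigr => i _.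
rewrite /ratio /coord_ratio; case: ifP => // _.
by rewrite /f null_ratioE.
Qed.

(** Smoothness around y0 bounds the density from below by a Gaussian factor, and by [shrunk_ge] each
    integrated coordinate retains at least the likelihood at u. Outside S0 the vector and u are both
    0, so nothing is lost. *)
Lemma denominator_ge (x : vec R n) :
  ((g #|S0| y0 * expR (- (c1 * #|S0|%:R)) * gauss_dens u x)%:E <=
   \int[lebesgue_vec R #|S0|]_t (likelihood x (vembed t) * (g #|S0| t)%:E))%E.
Proof.
set C := g _ _ * _.
have C0 : 0 <= C by rewrite mulr_ge0 ?expR_ge0 ?dens_ge0.
pose f i t := expR (- ((t - tnth u i) ^+ 2 / 64)) * normal_pdf t 1 (tnth x i).
have mf i : measurable_fun setT (f i).
  apply: measurable_funM; last exact: measurable_normal_pdf_mean.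
  apply: measurableT_comp => //; apply: measurable_funN.
  apply: measurable_funM; last exact: measurable_cst.
  by apply: measurable_funX; exact: measurable_funB.
have f0 i t : 0 <= f i t by rewrite mulr_ge0 ?expR_ge0 ?normal_pdf_ge0.
apply: (@le_trans _ _ (\int[lebesgue_vec R #|S0|]_t
    (C%:E * (\prod_(i < n) f i (tnth (vembed t) i))%:E)))%E; last first.
  apply: ge0_le_integralT => t; first by rewrite -EFinM lee_fin mulr_ge0 ?prodr_ge0.
  rewrite /likelihood -!EFinM lee_fin.
  rewrite /f big_split/= prod_expR mulrA mulrC -/(gauss_dens _ _).
  rewrite ler_wpM2l ?(ltW (gauss_dens_gt0 _ _))//.
  rewrite /C -[leLHS]mulrA -expRD -[leRHS]lnK ?posrE ?(smooth_dens_gt0 smooth_g)//.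
  rewrite -[X in X * _]lnK ?posrE ?(smooth_dens_gt0 smooth_g)// -expRD ler_expR.
  have := smooth_ln smooth_g y0 t.
  rewrite l2dist_vembed_sqr -/u l2dist_sqr sumrN -mulr_suml.
  under eq_bigr do rewrite -sqrrN opprB.
  lra.
rewrite ge0_integralZl//=; last 2 first.
- apply/measurable_EFinP; apply: measurable_prod => i _.
  apply: (measurableT_comp (mf i)).
  exact: (measurableT_comp (measurable_tnth i) (@measurable_vembed _ _ S0)).
- by move=> t _; rewrite lee_fin prodr_ge0.
rewrite (@integral_prod_vembed _ _ S0 f (fun i => Num.sqrt (64 * pi / 33)
   * expR (16 / 33 * (tnth x i - tnth u i) ^+ 2)
   * normal_pdf (tnth u i) 1 (tnth x i)))//; last first.
  by move=> i _; exact: integral_shrunk.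
rewrite -EFinM lee_fin ler_wpM2l// /gauss_dens.
apply: ler_prod => i _; rewrite normal_pdf_ge0/=.
case: ifPn => [_|iS]; first exact: shrunk_ge.
by rewrite /f /u tnth_vembed_notin// subr0 expr0n/= mul0r oppr0 expR0 mul1r.
Qed.

(** The part of the bound on N_S / D that does not depend on the observation. The 3 |S0| is 2 |S0|
    from the numerator plus |S0| from the denominator; the density at y0 and the likelihood at u
    have cancelled. *)
Let penalty (S : {set 'I_n}) : R :=
  weight S / weight S0 * expR (c1 * (#|S|%:R + 3 * #|S0|%:R) - 3 / 32 * M ^+ 2).

Let penalty_ge0 S : 0 <= penalty S.
Proof. by rewrite mulr_ge0 ?expR_ge0// divr_ge0// ltW. Qed.

Lemma posterior_le (x : vec R n) : (0 <= posterior pin g far x <=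
  (\sum_(S : {set 'I_n}) Num.sqrt (penalty S) *
     \prod_(i < n) Num.sqrt (ratio S i (tnth x i)))%:E)%E.
Proof.
have mfar : measurable far.
  rewrite (_ : far = (fun t => l2dist t theta0) @^-1` `]M, +oo[%classic).
    by rewrite -[X in measurable X]setTI; exact: measurable_l2dist.
  by apply/seteqP; split=> t /=; rewrite in_itv/= andbT.
have mlik : measurable_fun setT (likelihood x).
  by apply/measurable_EFinP; exact: measurable_gauss_dens_mean.
have lik_far_ge0 t : (0 <= (likelihood x \_ far) t)%E by exact: erestrict_ge0.
have mlik_far : measurable_fun setT (likelihood x \_ far).
  by apply: (measurable_restrictT _ mfar).1; exact: measurable_funTS.
have int_ge0 (S : {set 'I_n}) (f : vec R n -> \bar R) :
    (forall t, 0 <= f t)%E -> (0 <= (weight S)%:E *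
      \int[lebesgue_vec R #|S|]_t (f (vembed t) * (g #|S| t)%:E))%E.
  move=> f0; rewrite mule_ge0 ?lee_fin ?(ltW (weight_gt0 _))//.
  by apply: integral_ge0 => t _; rewrite mule_ge0 ?lee_fin ?dens_ge0.
rewrite /posterior integral_mkcond -/(likelihood x).
rewrite (integral_prior _ _ mlik_far lik_far_ge0).
rewrite (integral_prior _ _ mlik (likelihood_ge0 x)) -sumEFin.
set D := (\sum_(S : {set 'I_n}) (_ * \int[_]_t (likelihood x _ * _)))%E .
(* Used twice: at S, to see that the numerator term is at most D, and at S0, to bound D from
   below. *)
have le_D (S : {set 'I_n}) : ((weight S)%:E *
   \int[lebesgue_vec R #|S|]_t (likelihood x (vembed t) * (g #|S| t)%:E) <= D)%E.
  by rewrite /D (bigD1 S)//= leeDl// sume_ge0// => T _; exact: int_ge0.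
rewrite ge0_sume_distrl; last by move=> S _; exact: int_ge0.
apply/andP; split.
  apply: sume_ge0 => S _; rewrite mule_ge0 ?int_ge0// inve_ge0.
  by apply: sume_ge0 => T _; exact: int_ge0.
apply: lee_sum => S _.
pose b := weight S0 * (g #|S0| y0 * expR (- (c1 * #|S0|%:R)) * gauss_dens u x).
have gy0 := smooth_dens_gt0 smooth_g y0.
have gu := gauss_dens_gt0 u x.
have w0 := weight_gt0 S0.
rewrite -sqrtr_prod; last by move=> i; exact: coord_ratio_ge0.
rewrite -sqrtrM//.
rewrite [X in Num.sqrt X](_ : _ = weight S *
  (g #|S0| y0 * expR (c1 * (#|S|%:R + 2 * #|S0|%:R) - 3 / 32 * M ^+ 2) * ((\prod_(i < n) ratio S i (tnth x i)) * gauss_dens u x)) / b).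
  apply: dive_le_sqrt.
  - exact: int_ge0.
  - apply: (le_trans _ (le_D S)).
    rewrite lee_wpmul2l ?lee_fin ?(ltW (weight_gt0 _))//.
    apply: ge0_le_integralT => t; first by rewrite mule_ge0 ?lee_fin ?dens_ge0.
    rewrite lee_wpmul2r ?lee_fin ?dens_ge0// patchE.
    by case: ifP.
  - rewrite (EFinM (weight S)) lee_wpmul2l ?lee_fin ?(ltW (weight_gt0 _))//.
    exact: numerator_le.
  - by rewrite /b (mulr_gt0 w0)// (mulr_gt0 _ gu)// (mulr_gt0 gy0)// expR_gt0.
  - apply: (le_trans _ (le_D S0)).
    by rewrite /b (EFinM (weight S0)) lee_wpmul2l ?lee_fin ?(ltW w0)// denominator_ge.
rewrite /penalty /b (_ : c1 * (#|S|%:R + 3 * #|S0|%:R) - 3 / 32 * M ^+ 2 =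
  (c1 * (#|S|%:R + 2 * #|S0|%:R) - 3 / 32 * M ^+ 2) + c1 * #|S0|%:R); last by ring.
rewrite expRD expRN; field.
by rewrite !gt_eqF ?expR_gt0.
Qed.

(** Multiplying by the density under theta0 keeps the product form, so the expectation factors over
    the coordinates. On S0 the vectors theta0 and u agree, hence only the squared coordinates
    outside S0, the bias, survive in the exponent. *)
Lemma expect_posterior_le :
  (gauss_expect theta0 (posterior pin g far) <=
   (\sum_(S : {set 'I_n}) Num.sqrt (penalty S) *
     (4 ^+ #|S| * expR (\sum_(i | i \notin S0) tnth theta0 i ^+ 2)))%:E)%E.
Proof.
pose f S i (x : R) := Num.sqrt (ratio S i x) * normal_pdf (tnth theta0 i) 1 x.
have f0 S i x : 0 <= f S i x by rewrite mulr_ge0 ?normal_pdf_ge0 ?sqrtr_ge0.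
have mf S i : measurable_fun setT (f S i).
  apply: measurable_funM; last exact: measurable_normal_pdf.
  exact: (measurableT_comp (@measurable_sqrtr R)).
have mfp S : measurable_fun setT
    (fun x : vec R n => (\prod_(i < n) f S i (tnth x i))%:E).
  apply/measurable_EFinP; apply: measurable_prod => i _.
  exact: (measurableT_comp (mf S i) (measurable_tnth i)).
apply: (@le_trans _ _ (\int[lebesgue_vec R n]_x
   \sum_(S : {set 'I_n}) ((Num.sqrt (penalty S))%:E *
      (\prod_(i < n) f S i (tnth x i))%:E))%E).
  apply: ge0_le_integralT => x; have /andP[p0 p1] := posterior_le x.
    by rewrite mule_ge0 ?lee_fin ?(ltW (gauss_dens_gt0 _ _)).
  apply: (le_trans (lee_wpmul2r _ p1)).
    by rewrite lee_fin (ltW (gauss_dens_gt0 _ _)).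
  rewrite -EFinM mulr_suml -sumEFin; apply: lee_sum => S _.
  by rewrite -EFinM lee_fin -mulrA /gauss_dens -big_split.
rewrite ge0_integral_sum//; last 2 first.
- by move=> S; apply: measurable_funeM.
- by move=> S x _; rewrite mule_ge0 ?lee_fin ?sqrtr_ge0 ?prodr_ge0.
rewrite -sumEFin; apply: lee_sum => S _.
rewrite ge0_integralZl//=; last by move=> x _; rewrite lee_fin prodr_ge0.
rewrite EFinM lee_wpmul2l ?lee_fin ?sqrtr_ge0//.
apply: (le_trans (@integral_lebesgue_vec_prod_le _ _ (f S)
  (fun i => (if i \in S then 4 else 1) *
     expR ((tnth theta0 i - tnth u i) ^+ 2)) _ _ _)) => //.
  move=> i; rewrite /f /ratio /coord_ratio; case: ifPn => iS.
    exact: integral_sqrt_free.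
  rewrite mul1r; apply: integral_sqrt_null.
  by rewrite /u tnth_vembed_vproj; case: ifP; [left|right].
rewrite lee_fin big_split/= prod_expR -big_mkcond/= prodr_const.
rewrite [X in expR X](bigID (mem S0))/= big1 ?add0r; last first.
  by move=> i iS; rewrite /u tnth_vembed_vproj iS subrr expr0n.
rewrite (eq_bigr (fun i => tnth theta0 i ^+ 2))// => i iS.
by rewrite /u tnth_vembed_notin// subr0.
Qed.

End posterior_bound.

(** * Counting subsets *)

Section counting.
Context (R : realType).

(** For k > 0 and x = k / n, one term of the binomial expansion gives C(n, k) x^k <= (1 + x)^n <=
    exp(n x) = exp(k). *)
Lemma binomial_le n k : (k <= n)%N ->
  'C(n, k)%:R <= expR (k%:R + k%:R * ln (n%:R / k%:R)) :> R.
Proof.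
case: k => [|k] kn; first by rewrite bin0 !mul0r addr0 expR0.
have n0 : 0 < n%:R :> R by rewrite ltr0n (leq_trans _ kn).
set K := k.+1 in kn *; have K0 : 0 < K%:R :> R by rewrite ltr0n.
pose x : R := K%:R / n%:R; have x0 : 0 < x by rewrite divr_gt0.
have -> : K%:R * ln (n%:R / K%:R) = - (ln x *+ K).
  rewrite -[n%:R / K%:R]invrK invf_div -/x lnV ?posrE// mulrN.
  by rewrite mulr_natl.
rewrite expRD expRN mulrC -ler_pdivrMl ?invr_gt0 ?expR_gt0// invrK.
rewrite -lnXn// lnK ?posrE ?exprn_gt0//.
apply: (@le_trans _ _ ((1 + x) ^+ n)).
  rewrite exprDn (bigD1 (inord K))//= inordK// expr1n mul1r mulr_natr.
  by rewrite lerDl sumr_ge0// => i _; rewrite mulrn_wge0// mulr_ge0// exprn_ge0 ?ltW.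
apply: (@le_trans _ _ (expR x ^+ n)).
  by rewrite lerXn2r ?nnegrE ?expR_ge0 ?expR_ge1Dx// addr_ge0 ?ltW.
rewrite -expRM_natl ler_expR /x mulrC divfK// gt_eqF//.
Qed.

Lemma expR1_ge2 : 2 <= expR 1 :> R.
Proof. by have := @expR_ge1Dx R 1; rewrite -[1 + 1]/(2%:R). Qed.

Lemma sum_half_le n : \sum_(k < n) (2^-1 : R) ^+ k <= 2.
Proof.
suff : \sum_(k < n) (2^-1 : R) ^+ k = 2 - 2 * 2^-1 ^+ n.
  by move=> ->; rewrite lerBlDr lerDl mulr_ge0// exprn_ge0.
elim: n => [|n IH]; first by rewrite big_ord0 expr0 mulr1 subrr.
by rewrite big_ord_recr/= IH exprS; field.
Qed.

Lemma sum_by_card n (f : nat -> R) :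
  \sum_(S : {set 'I_n}) f #|S| = \sum_(k < n.+1) 'C(n, k)%:R * f k.
Proof.
rewrite (partition_big (fun S : {set 'I_n} => inord #|S| : 'I_n.+1) xpredT)//=.
apply: eq_bigr => k _.
have cardS (S : {set 'I_n}) : (inord #|S| == k) = (#|S| == k :> nat).
  rewrite -(inj_eq val_inj)/= inordK// ltnS.
  by rewrite -[X in (_ <= X)%N]card_ord max_card.
rewrite (eq_bigr (fun=> f k)); last by move=> S; rewrite cardS => /eqP ->.
rewrite (eq_bigl (fun S : {set 'I_n} => #|S| == k) _ cardS) sumr_const.
rewrite -[LHS]mulr_natl; congr (_%:R * _).
have := card_draws 'I_n k; rewrite card_ord => <-.
by apply: eq_card => S; rewrite !inE.
Qed.

End counting.

(** * Summation over the subsets *)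

Section penalty_sum.
Context (R : realType) (n : nat) (pin : dim_prior R n) (a b K c1 : R).
Hypothesis n_gt0 : (0 < n)%N.
Hypothesis c1_ge0 : 0 <= c1.
Hypothesis a_ge1 : 1 <= a.
Hypothesis b_ge : expR (7 + 2 * c1) <= b.
Hypothesis pin_le : forall p : nat, (p <= n)%N ->
  pin p <= K * expR (- (a * p%:R * ln (b * n%:R / p%:R))).

Lemma dim_prior_const_gt0 : 0 < K.
Proof.
have := lt_le_trans (dimp_gt0 pin (leq0n n)) (pin_le (leq0n n)).
by rewrite pmulr_lgt0 ?expR_gt0.
Qed.

Let ln_ratio_ge0 (k : nat) : (k <= n)%N -> 0 <= k%:R * ln (n%:R / k%:R : R).
Proof.
case: k => [|k] kn; first by rewrite mul0r.
rewrite mulr_ge0// ln_ge0// ler_pdivlMr ?ltr0n// mul1r ler_nat//.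
Qed.

(** Since ln b >= 7 + 2 c1 >= 0 and ln (n / k) >= 0 for k > 0, the quantity k ln (b n / k) is
    nonnegative, and replacing a by 1 only weakens the bound. *)
Lemma dim_prior_le (k : nat) : (k <= n)%N ->
  pin k <= K * expR (- ((7 + 2 * c1) * k%:R + k%:R * ln (n%:R / k%:R))).
Proof.
move=> kn; apply: (le_trans (pin_le kn)).
rewrite ler_pM2l ?dim_prior_const_gt0// ler_expR lerN2.
case: k kn => [|k] kn; first by rewrite !mulr0 !mul0r addr0.
have b0 : 0 < b by apply: lt_le_trans b_ge; exact: expR_gt0.
have n0 : 0 < n%:R :> R by rewrite ltr0n.
have lnb : 7 + 2 * c1 <= ln b by rewrite -[leLHS]expRK ler_ln ?posrE ?expR_gt0.
have l0 := ln_ratio_ge0 kn.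
rewrite -(mulrA b) lnM ?posrE ?divr_gt0 ?ltr0n//.
rewrite -[a * _ * _]mulrA mulrDr.
have kb : (7 + 2 * c1) * k.+1%:R <= k.+1%:R * ln b by rewrite mulrC ler_wpM2l.
apply: (@le_trans _ _ (k.+1%:R * ln b + k.+1%:R * ln (n%:R / k.+1%:R))).
  by rewrite lerD2r.
rewrite ler_peMl// addr_ge0//; apply: le_trans kb.
by rewrite mulr_ge0// addr_ge0// mulr_ge0.
Qed.

(** The C(n, k) subsets of size k carry sqrt (C(n, k) pi_n(k)) in all, at most sqrt K exp(- (3 + c1)
    k) by [binomial_le] and [dim_prior_le]. With the extra factor, the ratio 4 exp(- 3 - c1 / 2) is
    at most 1/2, as exp 3 >= 8, and a geometric series remains. *)
Lemma sqrt_weight_sum_le :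
  \sum_(S : {set 'I_n}) Num.sqrt (pin #|S| / 'C(n, #|S|)%:R)
     * (4 * expR (c1 / 2)) ^+ #|S| <= 2 * Num.sqrt K.
Proof.
rewrite (@sum_by_card R n (fun k => Num.sqrt (pin k / 'C(n, k)%:R)
  * (4 * expR (c1 / 2)) ^+ k)).
apply: (@le_trans _ _ (\sum_(k < n.+1) Num.sqrt K * (2^-1) ^+ k)); last first.
  by rewrite -mulr_sumr mulrC ler_wpM2r// sum_half_le.
apply: ler_sum => k _; have kn : (k <= n)%N by rewrite -ltnS.
have C0 : 0 < 'C(n, k)%:R :> R by rewrite ltr0n bin_gt0.
rewrite mulrA.
have -> : 'C(n, k)%:R * Num.sqrt (pin k / 'C(n, k)%:R) =
    Num.sqrt ('C(n, k)%:R * pin k).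
  rewrite -[X in X * _]ger0_norm ?ltW// -sqrtr_sqr -sqrtrM ?sqr_ge0//.
  by congr Num.sqrt; field; rewrite gt_eqF.
have le1 : Num.sqrt ('C(n, k)%:R * pin k) <= Num.sqrt K * expR (- (3 + c1)) ^+ k.
  rewrite -expRM_natl -[expR _]ger0_norm ?expR_ge0// -sqrtr_sqr.
  rewrite -sqrtrM ?(ltW dim_prior_const_gt0)// ler_wsqrtr//.
  rewrite -expRM_natl.
  apply: (le_trans (ler_pM _ _ (binomial_le R kn) (dim_prior_le kn))) => //.
    exact/ltW/dimp_gt0.
  rewrite mulrCA -expRD ler_pM2l ?dim_prior_const_gt0// ler_expR.
  lra.
apply: (le_trans (ler_wpM2r _ le1)).
  by rewrite exprn_ge0// mulr_ge0// expR_ge0.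
rewrite -mulrA ler_wpM2l// -exprMn lerXn2r ?nnegrE ?mulr_ge0 ?expR_ge0//.
rewrite mulrCA -expRD (_ : - (3 + c1) + c1 / 2 = - 3 - c1 / 2); last by lra.
have e3 : 8 <= expR 3 :> R.
  rewrite -[X in expR X]mulr1 expRM_natl.
  rewrite (_ : 8 = 2 ^+ 3 :> R); last by ring.
  by rewrite lerXn2r ?nnegrE ?expR_ge0 ?expR1_ge2.
have : expR (- 3 - c1 / 2) <= 8^-1.
  apply: (@le_trans _ _ (expR (- 3))); first by rewrite ler_expR; have := c1_ge0; lra.
  by rewrite expRN lef_pV2 ?posrE ?expR_gt0.
lra.
Qed.

Lemma penalty_sum_le (p : nat) (rho rn r : R) : (0 < p <= n)%N ->
  0 <= rn -> 0 <= r ->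
  p%:R * ln (n%:R / p%:R) <= rn ^+ 2 -> ln (pin p)^-1 <= rn ^+ 2 ->
  rho <= rn ^+ 2 ->
  \sum_(S : {set 'I_n})
    Num.sqrt (pin #|S| / 'C(n, #|S|)%:R / (pin p / 'C(n, p)%:R) *
      expR (c1 * (#|S|%:R + 3 * p%:R) - 3 / 32 * (80 * rn + 20 * r) ^+ 2)) *
    (4 ^+ #|S| * expR rho) <= 2 * K * Num.sqrt K * expR (- (r ^+ 2 / 10)).
Proof.
move=> /andP[p0 pn] rn0 r0 entropy prior_p rho_le.
(* The estimates below end with exp(3 rn^2 - Q / 2), which this inequality turns into exp(- r^2 /
   10). *)
have : 6 * rn ^+ 2 + r ^+ 2 / 5 <= 3 / 32 * (80 * rn + 20 * r) ^+ 2.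
  have := mulr_ge0 rn0 r0; have := sqr_ge0 rn; have := sqr_ge0 r.
  by rewrite !expr2; lra.
move: (3 / 32 * _) => Q Q_ge.
have K0 := dim_prior_const_gt0.
have pin0 : 0 < pin p by exact: dimp_gt0.
have C0 k : (k <= n)%N -> 0 < 'C(n, k)%:R :> R by move=> kn; rewrite ltr0n bin_gt0.
have pinV : (pin p)^-1 <= expR (rn ^+ 2).
  by rewrite -[leLHS]lnK ?posrE ?invr_gt0// ler_expR.
have CpV : 'C(n, p)%:R <= expR (p%:R + rn ^+ 2).
  by apply: (le_trans (binomial_le R pn)); rewrite ler_expR lerD2l.
(* [B] gathers what does not depend on S: p / 2 + rn^2 is half the exponent bounding C(n, p) /
   pi_n(p). The remaining c1 |S| / 2 joins 4 ^+ |S|. *)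
pose B := expR (p%:R / 2 + rn ^+ 2 + 3 / 2 * c1 * p%:R
  - Q / 2 + rho).
apply: (@le_trans _ _ (\sum_(S : {set 'I_n})
  (Num.sqrt (pin #|S| / 'C(n, #|S|)%:R) * (4 * expR (c1 / 2)) ^+ #|S|) * B)).
  apply: ler_sum => S _.
  have Sn : (#|S| <= n)%N by rewrite -[leqRHS]card_ord max_card.
  have w0 : 0 <= pin #|S| / 'C(n, #|S|)%:R.
    by rewrite ltW// divr_gt0 ?dimp_gt0 ?C0.
  rewrite -mulrA sqrtrM// [Num.sqrt (_ * expR _)]sqrtrM; last first.
    by rewrite invr_ge0 divr_ge0 ?ltW ?C0.
  rewrite -!mulrA ler_wpM2l// sqrtr_expR exprMn -!mulrA.
  rewrite [X in _ <= X](_ : _ = 4 ^+ #|S| * (expR (c1 / 2) ^+ #|S| * B)); last by [].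
  rewrite [leLHS]mulrA [leLHS]mulrCA ler_wpM2l ?exprn_ge0//.
  apply: (@le_trans _ _ (expR (p%:R / 2 + rn ^+ 2) *
    expR ((c1 * (#|S|%:R + 3 * p%:R) - Q) / 2) * expR rho)).
    rewrite !ler_wpM2r ?expR_ge0//.
    rewrite -[leRHS]ger0_norm ?expR_ge0// -sqrtr_sqr ler_wsqrtr//.
    rewrite invf_div -expRM_natl mulrDr.
    rewrite (_ : 2%:R * (p%:R / 2) + 2%:R * rn ^+ 2 = (p%:R + rn ^+ 2) + rn ^+ 2);
      last by field.
    by rewrite [leRHS]expRD; apply: ler_pM => //; rewrite invr_ge0 ltW.
  rewrite -!expRD -expRM_natl -expRD ler_expR; lra.
rewrite -mulr_suml.
have B0 : 0 <= B by exact: expR_ge0.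
apply: (le_trans (ler_wpM2r B0 sqrt_weight_sum_le)).
rewrite -!mulrA ler_pM2l// [leRHS]mulrCA ler_wpM2l//.
(* The dimension p is itself controlled by rn^2: pi_n(p) is at least exp(- rn^2) by the choice of p
   and at most K exp(- (7 + 2 c1) p) by assumption. This absorbs the terms of [B] in p, at the price
   of a factor K. *)
have Kp : expR ((7 + 2 * c1) * p%:R) <= K * expR (rn ^+ 2).
  have := dim_prior_le pn; rewrite opprD expRD.
  have l1 : expR (- (p%:R * ln (n%:R / p%:R))) <= 1 :> R.
    by rewrite -[leRHS]expR0 ler_expR oppr_le0 ln_ratio_ge0.
  move=> h; have {h} : pin p <= K * expR (- ((7 + 2 * c1) * p%:R)).
    apply: (le_trans h); rewrite ler_pM2l// ler_piMr ?expR_ge0//.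
  rewrite expRN ler_pdivlMr ?expR_gt0// => h.
  have := ler_wpM2l (ltW K0) pinV; apply: le_trans.
  by rewrite ler_pdivlMr// mulrC.
have Bpos : B <= expR ((7 + 2 * c1) * p%:R) * expR (2 * rn ^+ 2 - Q / 2).
  rewrite -expRD ler_expR.
  have : 0 <= c1 * p%:R by rewrite mulr_ge0.
  have : 0 <= p%:R :> R by [].
  lra.
apply: (le_trans Bpos); apply: (le_trans (ler_wpM2r (expR_ge0 _) Kp)).
by rewrite -mulrA ler_pM2l// -expRD ler_expR; lra.
Qed.

End penalty_sum.

(** * Approximation bias over the weak ball *)

Section weak_ball_bias.
Context (R : realType).

(** With y = 1 / (j + 1) one has 1 / j = y / (1 - y), so after division by y^c the claim reads 1 + c
    y <= (1 - y)^(- c). It follows from exp z >= 1 + z and ln (1 - y) <= - y. *)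
Lemma powR_tail_step (c : R) (j : nat) : 0 < c -> (0 < j)%N ->
  c * j.+1%:R^-1 `^ (c + 1) <= j%:R^-1 `^ c - j.+1%:R^-1 `^ c.
Proof.
move=> c0 j0; set y := j.+1%:R^-1.
have y0 : 0 < y :> R by rewrite invr_gt0 ltr0n.
have jr : 0 < j%:R :> R by rewrite ltr0n.
have yj : 0 < 1 - y.
  by rewrite subr_gt0 invf_lt1 ?ltr0n// ltr1n.
have -> : j%:R^-1 = y * (1 - y)^-1.
  have -> : 1 - y = y * j%:R.
    by rewrite -[X in X - _](mulVf (_ : j.+1%:R != 0))// -/y -natr1; ring.
  by rewrite invfM mulrA divff ?mul1r ?gt_eqF.
rewrite powRM ?(ltW y0) ?invr_ge0 ?(ltW yj)// powRD; last by rewrite (gt_eqF y0) implybT.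
rewrite powRr1 ?(ltW y0)// -[X in _ <= _ - X]mulr1 -mulrBr mulrCA ler_wpM2l ?powR_ge0//.
rewrite /powR invr_eq0 gt_eqF// lnV ?posrE// mulrN.
have := expR_ge1Dx (- (c * ln (1 - y))).
have : c * ln (1 - y) <= c * (- y).
  by rewrite ler_wpM2l ?(ltW c0)//; have := le_ln1Dx (_ : -1 < - y); apply; lra.
lra.
Qed.

(** The bounds of [powR_tail_step] telescope, a discrete form of comparing the tail with an
    integral. *)
Lemma powR_tail_sum (c : R) (p n : nat) : 0 < c -> (0 < p)%N -> (p <= n)%N ->
  \sum_(p <= i < n) i.+1%:R^-1 `^ (c + 1) <= c^-1 * p%:R^-1 `^ c.
Proof.
move=> c0 p0 pn; rewrite ler_pdivlMl// mulr_sumr.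
apply: (@le_trans _ _ (\sum_(p <= i < n) (i%:R^-1 `^ c - i.+1%:R^-1 `^ c))).
  rewrite big_nat [leRHS]big_nat; apply: ler_sum => i /andP[pi _].
  by apply: powR_tail_step => //; exact: leq_trans pi.
under eq_bigr do rewrite -opprB; rewrite sumrN telescope_sumr// opprB.
by rewrite lerBlDr lerDl powR_ge0.
Qed.

Lemma rearr_ge0 n (x : vec R n) i : 0 <= rearr x i.
Proof.
rewrite /rearr; case: (ltnP i (size (sort (fun s t : R => t <= s) [seq `|t| | t <- x]))).
  move=> /(mem_nth 0); rewrite mem_sort => /mapP[t _ ->]; exact: normr_ge0.
by move=> h; rewrite nth_default.
Qed.

Lemma best_subset n (x : vec R n) (p : nat) : (0 < n)%N -> (p <= n)%N ->
  exists S : {set 'I_n}, #|S| = p /\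
    \sum_(i | i \notin S) tnth x i ^+ 2 <= \sum_(p <= k < n) rearr x k ^+ 2.
Proof.
move=> n0 pn; pose i0 : 'I_n := Ordinal n0.
(* Sorting the indices by decreasing absolute value makes the rearrangement the list of absolute
   values along [s]; the witness is the set of the first p indices. *)
pose s := sort (relpre (fun i => `|tnth x i|) (fun s t : R => t <= s)) (enum 'I_n).
have us : uniq s by rewrite sort_uniq enum_uniq.
have ss : size s = n by rewrite size_sort size_enum_ord.
have rE k : (k < n)%N -> rearr x k = `|tnth x (nth i0 s k)|.
  move=> kn; rewrite /rearr -[X in map _ X]map_tnth_enum -map_comp sort_map.
  by rewrite (nth_map i0) ?ss.
exists [set i in take p s]; split.
  by rewrite cardsE (card_uniqP _) ?take_uniq// size_takel// ss.
rewrite (perm_big s)/=; last first.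
  apply: uniq_perm; rewrite ?index_enum_uniq// => i.
  by rewrite mem_index_enum mem_sort mem_enum.
rewrite -[X in \sum_(i <- X | _) _](cat_take_drop p s) big_cat/=.
rewrite big1_seq ?add0r; last first.
  by move=> i /andP[]; rewrite inE => /negbTE ->.
apply: (@le_trans _ _ (\sum_(i <- drop p s) tnth x i ^+ 2)).
  rewrite big_mkcond/=; apply: ler_sum => i _.
  by case: ifP => // _; exact: sqr_ge0.
rewrite (big_nth i0) size_drop ss -{3}(add0n p) big_addn.
rewrite big_nat [leRHS]big_nat; apply: ler_sum => k /andP[_ kn].
rewrite nth_drop [(k + p)%N]addnC rE -?ltn_subRL//.
by rewrite real_normK ?num_real.
Qed.

(** The maximum in [weak_ball] dominates its term i; solving for the s-th power and raising to the
    power 2 / s gives the bound. *)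
Lemma weak_ball_rearr n (x : vec R n) (s pn : R) (i : nat) :
  0 < s -> 0 <= pn -> weak_ball s pn x -> (i < n)%N ->
  rearr x i ^+ 2 <=
  n%:R `^ (2 / s) * i.+1%:R^-1 `^ (2 / s) * (pn / n%:R) ^+ 2.
Proof.
move=> s0 pn0 xb ni; have n0 : 0 < n%:R :> R by rewrite ltr0n (leq_ltn_trans _ ni).
have i0 : 0 < i.+1%:R :> R by rewrite ltr0n.
have bnd : rearr x i `^ s <= n%:R * i.+1%:R^-1 * (pn / n%:R) `^ s.
  rewrite mulrAC ler_pdivlMr// mulrC -ler_pdivrMl//; apply: le_trans xb.
  rewrite ler_pM2l ?invr_gt0//.
  exact: (le_bigmax _ (fun i : 'I_n => i.+1%:R * rearr x i `^ s) (Ordinal ni)).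
have q0 : 0 <= 2 / s by rewrite divr_ge0 ?ltW.
have sE (t : R) : 0 <= t -> (t `^ s) `^ (2 / s) = t ^+ 2.
  by move=> t0; rewrite -powRrM mulrCA divff ?gt_eqF// mulr1 powR_mulrn.
rewrite -sE ?rearr_ge0//.
have ni0 : 0 <= n%:R * i.+1%:R^-1 :> R by rewrite divr_ge0.
apply: (le_trans (ge0_ler_powR q0 _ _ bnd)); rewrite ?nnegrE ?powR_ge0//.
  by rewrite mulr_ge0 ?powR_ge0.
by rewrite [(_ * _ `^ s) `^ _]powRM ?powR_ge0// sE ?divr_ge0// powRM ?invr_ge0.
Qed.

(** The p largest coordinates are kept. The squares of the others are summed by [powR_tail_sum] with
    exponent q = 2 / s - 1, positive because s < 2; as 1 / q = s / (2 - s), the result is the first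
    term of [rate_term]. *)
Lemma weak_ball_bias n (x : vec R n) (s pn : R) (p : nat) :
  0 < s < 2 -> 0 <= pn -> weak_ball s pn x -> (0 < p <= n)%N ->
  exists S : {set 'I_n}, #|S| = p /\
    \sum_(i | i \notin S) tnth x i ^+ 2 <=
    s * n%:R `^ (2 / s) / (2 - s) * p%:R^-1 `^ (2 / s - 1) * (pn / n%:R) ^+ 2.
Proof.
move=> /andP[s0 s2] pn0 xb /andP[p0 pn_le].
have [S [cS Sle]] := best_subset x (leq_trans p0 pn_le) pn_le.
exists S; split => //; apply: (le_trans Sle).
pose q := 2 / s - 1; have q0 : 0 < q by rewrite subr_gt0 ltr_pdivlMr ?mul1r.
have qE : 2 / s = q + 1 by rewrite subrK.
apply: (@le_trans _ _ (\sum_(p <= i < n)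
   (n%:R `^ (2 / s) * (pn / n%:R) ^+ 2) * i.+1%:R^-1 `^ (q + 1))).
  rewrite big_nat [leRHS]big_nat; apply: ler_sum => i /andP[_ ni].
  by rewrite mulrAC -qE; exact: weak_ball_rearr.
rewrite -mulr_sumr.
have -> : s * n%:R `^ (2 / s) / (2 - s) * p%:R^-1 `^ (2 / s - 1) * (pn / n%:R) ^+ 2
  = n%:R `^ (2 / s) * (pn / n%:R) ^+ 2 * (q^-1 * p%:R^-1 `^ q).
  have -> : q^-1 = s / (2 - s).
    by rewrite /q; field; rewrite !gt_eqF// subr_gt0.
  by rewrite -/q; move: (pn / n%:R) => w; field; rewrite gt_eqF// subr_gt0.
by rewrite ler_wpM2l ?mulr_ge0 ?powR_ge0 ?sqr_ge0// powR_tail_sum.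
Qed.

Lemma rate_sq_attained n (pin : nat -> R) (s pn : R) : (0 < n)%N ->
  exists2 p, (0 < p <= n)%N & rate_sq n pin s pn = rate_term n pin s pn p.
Proof.
move=> n0; rewrite /rate_sq big_nat.
apply: (big_ind (fun y => exists2 p, (0 < p <= n)%N & y = rate_term n pin s pn p)).
- by exists 1%N.
- move=> y z [p pP ->] [q qP ->]; rewrite /Num.min.
  by case: ifP => _; [exists p | exists q].
- by move=> p pP; exists p.
Qed.

End weak_ball_bias.

(** * The contraction bound over the weak ball *)

Theorem theorem2p6 (R : realType)
    (pin : forall n : nat, dim_prior R n)
    (g : forall n p : nat, density R p)
    (c1 a b K : R)
    (moment2_g : forall (n : nat) (S : {set 'I_n}), (0 < n)%N ->
      (\int[lebesgue_vec R #|S|]_x (l2norm x ^+ 2 * g n #|S| x)%:E < +oo)%E)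
    (smooth_g : forall (n : nat) (S : {set 'I_n}), (0 < n)%N ->
      forall x y : vec R #|S|,
        (lne (g n #|S| x)%:E - lne (g n #|S| y)%:E
           <= (c1 * #|S|%:R + 1 / 64%:R * l2dist x y ^+ 2)%:E)%E)
    (nested_g : forall (n : nat) (S S' : {set 'I_n}), (0 < n)%N ->
      S' \subset S ->
      forall x : vec R #|S|,
        (`|lne (g n #|S| x)%:E - lne (g n #|S'| (vproj S' (vembed x)))%:E|
           <= (c1 * #|S|%:R
               + 1 / 64%:R * l2norm (vproj (S :\: S') (vembed x)) ^+ 2)%:E)%E)
    (a_ge1 : 1 <= a)
    (b_ge : expR (7 + 2 * c1) <= b)
    (pin_le : forall n p : nat, (0 < n)%N -> (p <= n)%N ->
      pin n p <= K * expR (- (a * p%:R * ln (b * n%:R / p%:R)))) :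
  exists K' : R, forall (n : nat) (pn s r rn : R),
    1 <= pn <= n%:R -> 0 < s < 2 -> 1 <= r ->
    0 <= rn -> rn ^+ 2 = rate_sq n (pin n) s pn ->
    (ereal_sup
       [set gauss_expect theta0
              (posterior (pin n) (g n)
                 [set theta | (80 * rn + 20 * r < l2dist theta theta0)%R])
       | theta0 in @weak_ball R n s pn]
     <= (K' * expR (- (r ^+ 2 / 10)))%:E)%E.
Proof.
(* Smoothness in dimension one with both arguments equal reads 0 <= c1. *)
have c1_ge0 : 0 <= c1.
  pose S : {set 'I_1} := [set ord0]%SET; pose x : vec R #|S| := [tuple 0 | _ < #|S|].
  have := smooth_ln (fun S => smooth_g 1%N S isT) x x.
  rewrite l2dist_sqr big1 => [|i _]; last by rewrite subrr expr0n.
  have S1 : #|S|%:R = 1 :> R by rewrite cards1.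
  by rewrite [X in c1 * X]S1; lra.
(* 2 sqrt K bounds the sum over subsets, and the other K comes from controlling p by rn^2. *)
exists (2 * K * Num.sqrt K) => n pn s r rn /andP[pn1 pn_n] s02 r1 rn0 rnE.
have n0 : (0 < n)%N by rewrite -(@ltr0n R); lra.
have r0 : 0 <= r by lra.
have pn0 : 0 <= pn by lra.
apply: ge_ereal_sup => _ [theta0 ball <-].
(* At a minimising p, each of the three quantities under the maximum is at most rn^2: the bias
   outside S, the entropy p ln (n / p) and the prior cost of p. *)
have [p p0n rate_p] := rate_sq_attained (pin n) s pn n0.
have [S [cS bias]] := weak_ball_bias s02 pn0 ball p0n.
have M0 : 0 <= 80 * rn + 20 * r by lra.
apply: (le_trans (expect_posterior_le (pin n) (fun S x y => smooth_g n S n0 x y)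
  (fun S S' => nested_g n S S' n0) c1_ge0 theta0 S M0)).
rewrite lee_fin cS.
apply: (penalty_sum_le n0 c1_ge0 a_ge1 b_ge (fun p => pin_le n p n0) p0n rn0 r0).
- by rewrite rnE rate_p /rate_term !le_max lexx orbT.
- by rewrite rnE rate_p /rate_term !le_max lexx orbT.
- by rewrite rnE rate_p /rate_term !le_max bias.
Qed.
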